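(* In the setting of the context, let $\mathcal{C}_h:L^2(\Omega)\to\mathbb{P}^1(\mathcal{T}_h)\cap H^1_0(\Omega)$ be a bounded linear map, and define the consistency error $\delta_h(u)\in V_h'$ by $\langle\delta_h(u),v_h\rangle_{V_h',V_h}:=a_h(\Pi_hu,v_h)-a(u,\mathcal{C}_h\mathsf{p}(v_h))$ for $v_h\in V_h$. Then for all $m\ge1$, $$\frac{C_{\mathrm{coerc}}}{4}\|u_h^m-\Pi_hu\|_{V_h}^2+\frac{(\mathcal{D}(u,o_h^m),1)}{\sum_{k=1}^m\alpha_k}\le\frac{(\mathcal{D}(u,o_h^0),1)}{\sum_{k=1}^m\alpha_k}+\frac1{C_{\mathrm{coerc}}}\|\delta_h(u)\|_{V_h'}^2+e_K(u_h^m)+e_h(u),$$ where $$e_K(u_h^m):=\inf_{v\in K}\big\{|a(u,\mathcal{C}_h\mathsf{p}(u_h^m)-v)-(f,\mathsf{p}(u_h^m)-v)|\big\},\qquad e_h(u):=|a(u,\mathcal{C}_hJ_hu-u)-(f,J_hu-u)|.$$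
   Context: Problem data. $\Omega\subset\mathbb{R}^n$, $n\in\{2,3\}$, is an open bounded Lipschitz domain, $(\cdot,\cdot)$ is the $L^2(\Omega)$ inner product, $f\in L^2(\Omega)$, and $\phi\in H^1(\Omega)\cap C^0(\overline\Omega)$ with $\phi\le 0$ on $\partial\Omega$. $K:=\{v\in H^1_0(\Omega): v\ge\phi\text{ a.e. in }\Omega\}$, $a(w,v):=(\nabla w,\nabla v)$, and $u\in K$ is the unique solution of $a(u,v-u)\ge(f,v-u)$ for all $v\in K$. Set $\mathcal{O}:=\{o\in L^2(\Omega): o(x)\in[\phi(x),\infty)\text{ for a.e. }x\}$. Legendre function. $R:\Omega\times\mathbb{R}\to\mathbb{R}\cup\{+\infty\}$ is a Carathéodory function such that for a.e. $x$ the map $R(x,\cdot)$ is a Legendre function with essential domain $[\phi(x),\infty)$ (proper, strictly convex, differentiable on the interior of its essential domain, with gradient singular only at the boundary of the domain) and supercoercive ($R(x,y)/|y|\to\infty$ as $|y|\to\infty$). $R^*(x,z):=\sup_{y\in\mathbb{R}}\{zy-R(x,y)\}$ is the convex conjugate, continuously differentiable and strictly convex in $z$. Superposition operators: $\mathcal{R}(w)(x):=R(x,w(x))$, $\nabla\mathcal{R}(w)(x):=\partial_yR(x,w(x))$, $\mathcal{R}^*(\psi)(x):=R^*(x,\psi(x))$, $\nabla\mathcal{R}^*(\psi)(x):=\partial_zR^*(x,\psi(x))$. Standing facts: $\nabla\mathcal{R}^*=(\nabla\mathcal{R})^{-1}$; $\nabla\mathcal{R}^*$ maps $L^\infty(\Omega)$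 into $\mathcal{O}$ with $\nabla\mathcal{R}^*(\psi)>\phi$ a.e., is continuous on $L^\infty(\Omega)$ and strictly monotone. Bregman divergence: $\mathcal{D}(w,v):=\mathcal{R}(w)-\mathcal{R}(v)-\nabla\mathcal{R}(v)(w-v)$ pointwise a.e. (which is $\ge0$), for $w$ in the domain of $\mathcal{R}$ and $v$ in the domain of $\nabla\mathcal{R}$. Mesh and spaces. $\mathcal{T}_h$ is a conforming shape-regular simplicial partition of $\Omega$, with interior facets $\mathcal{F}_h$ and boundary facets $\mathcal{F}_h^\partial$; $h_F$ is the diameter of $F$; $[v]$ is the jump of $v$ across an interior facet and its trace on a boundary facet. $H^1(\mathcal{T}_h)$ is the broken $H^1$-space, $\|v\|_{\mathrm{DG}}^2:=\sum_{T\in\mathcal{T}_h}\|\nabla v\|_{L^2(T)}^2+\sum_{F\in\mathcal{F}_h\cup\mathcal{F}_h^\partial}h_F^{-1}\|[v]\|_{L^2(F)}^2$, and $\mathbb{P}^p(\mathcal{T}_h)$ is the space of functions that are polynomials of degree at most $p$ on each $T$. Abstract discretization. $V_h$ is a finite-dimensional real vector space with norm $\|\cdot\|_{V_h}$ (dual $V_h'$ with dual norm), $W_h:=\mathbb{P}^0(\mathcal{T}_h)$, $V_{\mathcal{T}_h}$ is a space with $\mathbb{P}^0(\mathcal{T}_h)\subseteq V_{\mathcal{T}_h}\subseteq\mathbb{P}^1(\mathcal{T}_h)$, $\mathsf{p}:V_h\to V_{\mathcal{T}_h}$ is linear with $W_h\subseteq\mathsf{p}(V_h)$, and $a_h:V_h\times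 V_h\to\mathbb{R}$ is a symmetric bilinear form. Assume there are positive constants such that: (i) $a_h(v_h,v_h)\ge C_{\mathrm{coerc}}\|v_h\|_{V_h}^2$ and $a_h(v_h,z_h)\le C_{\mathrm{cont}}\|v_h\|_{V_h}\|z_h\|_{V_h}$ for all $v_h,z_h\in V_h$; (ii) $\|\mathsf{p}(v_h)\|_{\mathrm{DG}}\le C_{\mathsf{p}}\|v_h\|_{V_h}$ for all $v_h\in V_h$; (iii) there is a linear map $\Pi_h:H^1(\mathcal{T}_h)\to V_h$ such that, with $J_h:=\mathsf{p}\circ\Pi_h$, for all $v\in H^1(\mathcal{T}_h)$: $(J_hv-v,w_h)=0$ for all $w_h\in W_h$, and $\|\Pi_hv\|_{V_h}\le C_\Pi\|v\|_{\mathrm{DG}}$. Iterates. Let $\psi_h^0\in W_h$ and let $(\alpha_k)_{k\ge1}$ be positive reals with $\sum_k\alpha_k=\infty$. For $k\ge1$, $(u_h^k,\psi_h^k)\in V_h\times W_h$ is the unique solution of $a_h(u_h^k,v_h)+\frac1{\alpha_k}(\mathsf{p}(v_h),\psi_h^k-\psi_h^{k-1})=(f,\mathsf{p}(v_h))$ for all $v_h\in V_h$ and $(\mathsf{p}(u_h^k),w_h)=(\nabla\mathcal{R}^*(\psi_h^k),w_h)$ for all $w_h\in W_h$. Set $o_h^k:=\nabla\mathcal{R}^*(\psi_h^k)$ for $k\ge0$. *)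

(* Defs.v *)
From HB Require Import structures.
From mathcomp Require Import all_boot all_order all_algebra.
From mathcomp Require Import all_classical all_reals all_analysis.
From mathcomp Require Import measurable_realfun lebesgue_Rintegral ess_sup_inf.

Set Implicit Arguments.
Unset Strict Implicit.
Unset Printing Implicit Defensive.

Import Order.TTheory GRing.Theory Num.Theory.
Import numFieldNormedType.Exports.

Local Open Scope classical_set_scope.
Local Open Scope ring_scope.

(* The product (= Borel) sigma-algebra on R^n, as for n.-tuple R. *)
Definition rV_coord (R : realType) (n : nat) (i : 'I_n) (x : 'rV[R]_n) :
  measurableTypeR R := x 0 i.

Section rV_measurable.
Context {R : realType} {n : nat}.

Let coord0 : g_sigma_preimage (@rV_coord R n) set0.
Proof. exact: sigma_algebra0. Qed.

Let coordC A : g_sigma_preimage (@rV_coord R n) A ->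
  g_sigma_preimage (@rV_coord R n) (~` A).
Proof. exact: sigma_algebraC. Qed.

Let coord_bigcup (F : _^nat) : (forall i, g_sigma_preimage (@rV_coord R n) (F i)) ->
  g_sigma_preimage (@rV_coord R n) (\bigcup_i (F i)).
Proof. exact: sigma_algebra_bigcup. Qed.

HB.instance Definition _ := @isMeasurable.Build default_measure_display
  'rV[R]_n (g_sigma_preimage (@rV_coord R n)) coord0 coordC coord_bigcup.

End rV_measurable.

Lemma measurable_coord (R : realType) n (i : 'I_n) :
  measurable_fun setT (@rV_coord R n i).
Proof.
move=> _ Y mY; rewrite setTI; apply: sub_sigma_algebra => /=.
rewrite -bigcup_seq/=; exists i => /=; first by rewrite mem_index_enum.
by exists Y => //; rewrite setTI.
Qed.

Lemma measurable_fun_coord (R : realType) d (T : measurableType d) n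
    (f : T -> 'rV[R]_n) :
  (forall i, measurable_fun setT (@rV_coord R n i \o f)) -> measurable_fun setT f.
Proof.
move=> mf; set G := \big[setU/set0]_(i < n)
  preimage_set_system setT (@rV_coord R n i) measurable.
have GE : measurable = <<s G >> by [].
apply: (measurability G GE) => _ [A GA <-].
move: GA; rewrite /G -bigcup_seq/= => -[i _ [B mB <-]].
by rewrite !setTI; have := mf i measurableT B mB; rewrite setTI.
Qed.

(* Lebesgue measure on R^n.+1 = R x R^n, from the one on R^n. *)
Section lebesgue_step.
Context {R : realType} {n : nat}.

Definition cons_rV (p : measurableTypeR R * 'rV[R]_n) : 'rV[R]_n.+1 :=
  row_mx (p.1)%:M p.2.

Let behead_rV (x : 'rV[R]_n.+1) : measurableTypeR R * 'rV[R]_n :=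
  (rV_coord (lshift n 0 : 'I_(1 + n)) x, rsubmx (x : 'rV_(1 + n))).

Lemma measurable_cons_rV : measurable_fun setT cons_rV.
Proof.
apply: measurable_fun_coord => i.
case: (@split_ordP 1 n i) => j ->.
  rewrite (_ : _ \o _ = fst) //; apply/funext => -[a v].
  by apply: (etrans (@row_mxEl _ 1 1 n _ v 0 j)); rewrite mxE !ord1 eqxx.
rewrite (_ : _ \o _ = @rV_coord R n j \o snd).
  by apply: measurableT_comp => //; exact: measurable_coord.
by apply/funext => -[a v]; exact: (@row_mxEr _ 1 1 n _ v 0 j).
Qed.

Let measurable_behead_rV : measurable_fun setT behead_rV.
Proof.
apply: measurable_fun_pair; first exact: measurable_coord.
apply: measurable_fun_coord => i.
rewrite (_ : _ \o _ = @rV_coord R n.+1 (rshift 1 i)); first exact: measurable_coord.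
by apply/funext => x; rewrite /= /rV_coord mxE.
Qed.

Let cons_rVK : cancel cons_rV behead_rV.
Proof.
move=> [a v]; rewrite /behead_rV /cons_rV row_mxKr; congr pair.
by apply: (etrans (@row_mxEl _ 1 1 n _ v 0 0)); rewrite mxE eqxx.
Qed.

Variable mu : {sigma_finite_measure set 'rV[R]_n -> \bar R}.

Definition lebesgue_step : set 'rV[R]_n.+1 -> \bar R :=
  pushforward (@lebesgue_measure R \x mu)%E cons_rV.

Let step0 : lebesgue_step set0 = 0%E.
Proof. by rewrite /lebesgue_step /pushforward preimage_set0 measure0. Qed.

Let step_ge0 A : (0 <= lebesgue_step A)%E.
Proof. by rewrite /lebesgue_step /pushforward; apply: measure_ge0. Qed.

Let step_sigma_additive : semi_sigma_additive lebesgue_step.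
Proof.
move=> F mF tF mUF; rewrite /lebesgue_step /pushforward preimage_bigcup.
have mcons A : measurable A -> measurable (cons_rV @^-1` A).
  by move=> mA; rewrite -[X in measurable X]setTI; exact: measurable_cons_rV.
apply: measure_semi_sigma_additive.
- by move=> k; exact: mcons.
- apply/trivIsetP => /= i j _ _ ij; rewrite -preimage_setI.
  by move/trivIsetP : tF => /(_ _ _ _ _ ij) ->//; rewrite preimage_set0.
- by rewrite -preimage_bigcup; exact: mcons.
Qed.

HB.instance Definition _ := isMeasure.Build _ _ _ lebesgue_step
  step0 step_ge0 step_sigma_additive.

Let step_sigma_finite : sigma_finite setT lebesgue_step.
Proof.
have /sigma_finiteP[F [TF ndF Foo]] := sigma_finiteT (@lebesgue_measure R).
have /sigma_finiteP[G [TG ndG Goo]] := sigma_finiteT mu.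
exists (fun k => behead_rV @^-1` (F k `*` G k)).
  apply/seteqP; split=> // x _; rewrite -preimage_bigcup /=.
  have [i _ Fi] : (\bigcup_i F i) (behead_rV x).1 by rewrite -TF.
  have [j _ Gj] : (\bigcup_i G i) (behead_rV x).2 by rewrite -TG.
  exists (maxn i j) => //; split.
    by move: Fi; apply/subsetPset/ndF/leq_maxl.
  by move: Gj; apply/subsetPset/ndG/leq_maxr.
move=> k; have [mF Fk] := Foo k; have [mG Gk] := Goo k; split.
  rewrite -[X in measurable X]setTI; apply: measurable_behead_rV => //.
  exact: measurableX.
rewrite /lebesgue_step /pushforward -comp_preimage.
rewrite (_ : _ @^-1` _ = F k `*` G k); last first.
  by rewrite (_ : behead_rV \o cons_rV = id)//; apply/funext => p; exact: cons_rVK.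
by rewrite product_measure1E// lte_mul_pinfty// ge0_fin_numE.
Qed.

HB.instance Definition _ := Measure_isSigmaFinite.Build _ _ _ lebesgue_step
  step_sigma_finite.

End lebesgue_step.

Fixpoint lebesgue (R : realType) (n : nat) :
    {sigma_finite_measure set 'rV[R]_n -> \bar R} :=
  if n is n'.+1 then lebesgue_step (lebesgue R n')
  else dirac (0 : 'rV[R]_0).

Section sobolev.
Context {R : realType} {n : nat}.
Local Notation E := 'rV[R]_n.
Local Notation leb := (lebesgue R n).
Implicit Types (D : set E) (v w g : E -> R).

Definition dotv (x y : E) : R := \sum_i x 0 i * y 0 i.

(* The norm `|x| of 'rV[R]_n is the max norm. *)
Definition enorm (x : E) : R := Num.sqrt (dotv x x).

Definition diam D : R := sup [set enorm (x - y) | x in D & y in D].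

Definition L2 D v : Prop := (v \_ D : E -> R) \in Lfun leb 2%:E.

Definition Linfty D v : Prop := (v \_ D : E -> R) \in Lfun leb +oo%E.

Definition normL2 D v : R := fine 'N[leb]_2%:E[EFin \o (v \_ D)].

Definition normLinfty D v : R := fine 'N[leb]_+oo%E[EFin \o (v \_ D)].

Definition ip D v w : R := \int[leb]_(x in D) (v x * w x).

Definition partial (i : 'I_n) v : E -> R := fun x => 'D_(delta_mx 0 i) v x.

Fixpoint Ck (k : nat) v : Prop :=
  if k is k'.+1 then
    forall i, (forall x, derivable v x (delta_mx 0 i)) /\ Ck k' (partial i v)
  else continuous v.

Definition smooth v : Prop := forall k, Ck k v.

Definition test_function D v : Prop :=
  [/\ smooth v, compact (closure [set x | v x != 0])
    & closure [set x | v x != 0] `<=` D].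

Definition is_weak_gradient D v (G : E -> E) : Prop :=
  (forall i, L2 D (fun x => G x 0 i)) /\
  forall i t, test_function D t ->
    ip D v (partial i t) = - ip D (fun x => G x 0 i) t.

Definition H1 D v : Prop := L2 D v /\ exists G, is_weak_gradient D v G.

(* Meaningful when H1 D v; determined up to a null subset of D. *)
Definition weak_gradient D v : E -> E :=
  xget (fun=> 0) [set G | is_weak_gradient D v G].

Definition grad_normL2_sq D v : R :=
  \sum_i normL2 D (fun x => weak_gradient D v x 0 i) ^+ 2.

Definition normH1 D v : R :=
  Num.sqrt (normL2 D v ^+ 2 + grad_normL2_sq D v).

Definition H10 D v : Prop :=
  H1 D v /\ forall eps, 0 < eps ->
    exists2 t, test_function D t & normH1 D (v \- t) < eps.

Definition dirichlet D w v : R :=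
  \int[leb]_(x in D) dotv (weak_gradient D w x) (weak_gradient D v x).

(* Near each boundary point, D is, for some unit direction nu, the part above
   the graph of a Lipschitz function gam of the component orthogonal to nu. *)
Definition lipschitz_domain D : Prop :=
  [/\ D !=set0, open D, connected D, bounded_set D &
    forall x, (closure D `\` D) x ->
      exists (nu : E) (gam : E -> R) (L r : R),
        [/\ dotv nu nu = 1, 0 < r,
            forall y s, gam (y + s *: nu) = gam y,
            forall y z, `|gam y - gam z| <= L * enorm (y - z)
          & forall y, enorm (y - x) < r -> (D y <-> gam y < dotv y nu)]].

End sobolev.

Section obstacle_problem.
Context {R : realType} {n : nat}.
Local Notation E := 'rV[R]_n.
Local Notation leb := (lebesgue R n).
Variables (Om : set E) (f phi : E -> R).

Definition admissible_obstacle : Prop :=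
  [/\ H1 Om phi, {within closure Om, continuous phi}
    & forall x, (closure Om `\` Om) x -> phi x <= 0].

Definition feasible : set (E -> R) :=
  [set v | H10 Om v /\ \forall x \ae leb, Om x -> phi x <= v x].

Definition solves_VI (u : E -> R) : Prop :=
  feasible u /\
  forall v, feasible v -> ip Om f (v \- u) <= dirichlet Om u (v \- u).

Definition obstacle_L2 : set (E -> R) :=
  [set o | L2 Om o /\ \forall x \ae leb, Om x -> phi x <= o x].

End obstacle_problem.

Section legendre.
Context {R : realType}.
Implicit Types (g : R -> \bar R) (c : R).

(* The values of g at the points of its essential domain [c, +oo[ are finite;
   fine turns them into reals. *)
Definition legendre c g : Prop :=
  [/\ forall y, g y != -oo%E,
      forall y, (g y < +oo)%E <-> c <= y,
      forall y z t, c <= y -> c <= z -> y != z -> 0 < t < 1 ->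
        fine (g (t * y + (1 - t) * z)) < t * fine (g y) + (1 - t) * fine (g z),
      forall y, c < y -> derivable (fine \o g) y 1
    & `|derive1 (fine \o g) y| @[y --> c^'+] --> +oo].

Definition supercoercive g : Prop :=
  forall A : R, exists r : R, forall y,
    r < `|y| -> (A%:E <= g y * (`|y|^-1)%:E)%E.

Definition conjugate g (z : R) : \bar R :=
  ereal_sup [set ((z * y)%:E - g y)%E | y in [set: R]].

End legendre.

Section superposition.
Context {R : realType} {n : nat}.
Local Notation E := 'rV[R]_n.
Local Notation leb := (lebesgue R n).
Variables (Om : set E) (phi : E -> R) (Rf : E -> R -> \bar R).

(* Rf x jumps to +oo at phi x, so that the continuity of a Caratheodory
   function is required on the essential domain. *)
Definition caratheodory_legendre : Prop :=
  (forall y, measurable_fun Om (Rf ^~ y)) /\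
  \forall x \ae leb, Om x ->
    [/\ {within [set y | phi x <= y], continuous (Rf x)},
        legendre (phi x) (Rf x) & supercoercive (Rf x)].

Definition grad_R (w : E -> R) : E -> R :=
  fun x => derive1 (fine \o Rf x) (w x).

Definition grad_Rstar (psi : E -> R) : E -> R :=
  fun x => derive1 (fine \o conjugate (Rf x)) (psi x).

Definition smooth_strictly_convex_conjugate : Prop :=
  \forall x \ae leb, Om x ->
    let h := conjugate (Rf x) in
    [/\ forall z, h z \is a fin_num,
        forall z, derivable (fine \o h) z 1,
        continuous (derive1 (fine \o h))
      & forall y z t, y != z -> 0 < t < 1 ->
          fine (h (t * y + (1 - t) * z))
            < t * fine (h y) + (1 - t) * fine (h z)].

Definition grad_Rstar_inverse : Prop :=
  \forall x \ae leb, Om x ->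
    (forall z, phi x < derive1 (fine \o conjugate (Rf x)) z /\
       derive1 (fine \o Rf x) (derive1 (fine \o conjugate (Rf x)) z) = z) /\
    (forall y, phi x < y ->
       derive1 (fine \o conjugate (Rf x)) (derive1 (fine \o Rf x) y) = y).

Definition grad_Rstar_superposition : Prop :=
  [/\ forall psi, Linfty Om psi ->
        obstacle_L2 Om phi (grad_Rstar psi) /\
        \forall x \ae leb, Om x -> phi x < grad_Rstar psi x,
      forall psi, Linfty Om psi -> forall eps, 0 < eps ->
        exists2 del, 0 < del & forall chi, Linfty Om chi ->
          normLinfty Om (chi \- psi) < del ->
          normL2 Om (grad_Rstar chi \- grad_Rstar psi) < eps
    & forall psi chi, Linfty Om psi -> Linfty Om chi ->
        ~ (psi = chi %[ae leb in Om]) ->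
        0 < ip Om (grad_Rstar psi \- grad_Rstar chi) (psi \- chi)].

Definition legendre_setting : Prop :=
  [/\ caratheodory_legendre, smooth_strictly_convex_conjugate,
      grad_Rstar_inverse & grad_Rstar_superposition].

Definition bregman (w v : E -> R) : E -> \bar R :=
  fun x => (Rf x (w x) - Rf x (v x) - (grad_R v x * (w x - v x))%:E)%E.

Definition bregman_integral (w v : E -> R) : \bar R :=
  (\int[leb]_(x in Om) bregman w v x)%E.

End superposition.

(* A simplex is given by the set of indices of its vertices. *)
Record mesh (R : realType) (n : nat) := Mesh {
  nb_vertices : nat;
  vertex : 'I_nb_vertices -> 'rV[R]_n;
  cells : {set {set 'I_nb_vertices}}
}.

Section meshes.
Context {R : realType} {n : nat}.
Local Notation E := 'rV[R]_n.
Local Notation leb := (lebesgue R n).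
Variables (Om : set E) (M : mesh R n).
Local Notation index_set := {set 'I_(nb_vertices M)}.
Implicit Types (T F S : index_set) (v : E -> R).

Definition closed_simplex S : set E :=
  [set x | exists l : 'I_(nb_vertices M) -> R,
    [/\ forall i, i \in S -> 0 <= l i, \sum_(i in S) l i = 1
      & x = \sum_(i in S) l i *: vertex i]].

Definition open_simplex S : set E :=
  [set x | exists l : 'I_(nb_vertices M) -> R,
    [/\ forall i, i \in S -> 0 < l i, \sum_(i in S) l i = 1
      & x = \sum_(i in S) l i *: vertex i]].

Definition affinely_independent S : Prop :=
  forall l : 'I_(nb_vertices M) -> R,
    \sum_(i in S) l i = 0 -> \sum_(i in S) l i *: vertex i = 0 ->
    forall i, i \in S -> l i = 0.

Definition conforming_partition : Prop :=
  [/\ forall T, T \in cells M -> #|T| = n.+1 /\ affinely_independent T,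
      forall T, T \in cells M -> open_simplex T `<=` Om,
      closure Om = \bigcup_(T in [set T | T \in cells M]) closed_simplex T
    & forall T T', T \in cells M -> T' \in cells M ->
        closed_simplex T `&` closed_simplex T' = closed_simplex (T :&: T')].

Definition inradius T : R :=
  sup [set r | 0 <= r /\
    exists c, forall y, enorm (y - c) <= r -> closed_simplex T y].

Definition shape_regular (kappa : R) : Prop :=
  forall T, T \in cells M -> diam (closed_simplex T) <= kappa * inradius T.

Definition is_facet F : bool :=
  (#|F| == n) && [exists T in cells M, F \subset T].

Definition facet_points F : seq E := [seq vertex i | i <- enum F].

Definition facet_edges F : 'M[R]_(n.-1, n) :=
  \matrix_(j < n.-1) ((facet_points F)`_j.+1 - (facet_points F)`_0).

Definition facet_map F (y : 'rV[R]_n.-1) : E :=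
  (facet_points F)`_0 + y *m facet_edges F.

Definition reference_simplex : set 'rV[R]_n.-1 :=
  [set y | (forall j, 0 <= y 0 j) /\ \sum_j y 0 j <= 1].

Definition facet_L2 F (t : E -> R) : Prop :=
  L2 reference_simplex (t \o facet_map F).

(* facet_map F has the constant surface Jacobian sqrt (det (A A^T)), where
   A := facet_edges F. *)
Definition facet_normL2_sq F (t : E -> R) : R :=
  Num.sqrt (\det (facet_edges F *m (facet_edges F)^T)) *
  normL2 reference_simplex (t \o facet_map F) ^+ 2.

(* The trace extends the restriction to F of smooth functions by continuity
   from H^1(T) to L^2(F). *)
Definition is_trace T F v (t : E -> R) : Prop :=
  facet_L2 F t /\
  exists w : nat -> E -> R,
    [/\ forall k, smooth (w k),
        normH1 (open_simplex T) (w k \- v) @[k --> \oo] --> 0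
      & facet_normL2_sq F (w k \- t) @[k --> \oo] --> 0].

Definition trace T F v : E -> R := xget (fun=> 0) [set t | is_trace T F v t].

(* An interior facet has two adjacent cells, a boundary facet has one. The sign
   of the jump depends on the enumeration of the cells. *)
Definition jump F v : E -> R :=
  match [seq T : index_set <- enum (cells M) | F \subset T] with
  | [:: T] => trace T F v
  | [:: T1; T2] => trace T1 F v \- trace T2 F v
  | _ => fun=> 0
  end.

Definition broken_H1 v : Prop :=
  L2 Om v /\ forall T, T \in cells M -> H1 (open_simplex T) v.

Definition normDG v : R :=
  Num.sqrt (\sum_(T in cells M) grad_normL2_sq (open_simplex T) v +
            \sum_(F | is_facet F)
              (diam (closed_simplex F))^-1 * facet_normL2_sq F (jump F v)).

Definition broken_poly (p : nat) v : Prop :=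
  L2 Om v /\ forall T, T \in cells M ->
    exists c : {ffun 'I_n -> 'I_p.+1} -> R,
      v = (fun x => \sum_(m : {ffun 'I_n -> 'I_p.+1} | (\sum_i m i <= p)%N)
                      c m * \prod_i x 0 i ^+ m i)
        %[ae leb in open_simplex T].

End meshes.

Definition finite_dimensional (R : realType) (V : normedModType R) : Prop :=
  exists (N : nat) (b : 'I_N -> V),
    forall v, exists c : 'I_N -> R, v = \sum_i c i *: b i.

Definition dual_norm (R : realType) (V : normedModType R) (l : V -> R) : R :=
  sup [set `|l v| | v in [set v | `|v| <= 1]].

Section discretization.
Context {R : realType} {n : nat} {Vh : normedModType R}.
Local Notation E := 'rV[R]_n.
Local Notation leb := (lebesgue R n).
Variables (Om : set E) (M : mesh R n).

(* Functions E -> R stand for their classes modulo equality a.e. in Om. *)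
Definition between_P0_P1 (VT : set (E -> R)) : Prop :=
  [/\ forall v, broken_poly Om M 0 v -> VT v,
      forall v, VT v -> broken_poly Om M 1 v
    & forall c v w, VT v -> VT w -> VT (fun x => c * v x + w x)].

Definition reconstruction (VT : set (E -> R)) (p : Vh -> E -> R) : Prop :=
  [/\ forall v, VT (p v),
      forall c v w, p (c *: v + w) = (fun x => c * p v x + p w x)
        %[ae leb in Om]
    & forall w, broken_poly Om M 0 w -> exists v, p v = w %[ae leb in Om]].

Definition symmetric_bilinear (ah : Vh -> Vh -> R) : Prop :=
  (forall v w, ah v w = ah w v) /\ forall v, scalar (ah v).

Definition coercive_bounded (ah : Vh -> Vh -> R) (Ccoerc Ccont : R) : Prop :=
  (forall v, Ccoerc * `|v| ^+ 2 <= ah v v) /\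
  forall v w, ah v w <= Ccont * `|v| * `|w|.

Definition quasi_interpolation (p : Vh -> E -> R) (CPi : R)
    (Pi : (E -> R) -> Vh) : Prop :=
  [/\ forall v w, broken_H1 Om M v -> broken_H1 Om M w ->
        v = w %[ae leb in Om] -> Pi v = Pi w,
      forall c v w, broken_H1 Om M v -> broken_H1 Om M w ->
        Pi (fun x => c * v x + w x) = c *: Pi v + Pi w,
      forall v, broken_H1 Om M v -> forall w, broken_poly Om M 0 w ->
        ip Om (p (Pi v) \- v) w = 0
    & forall v, broken_H1 Om M v -> `|Pi v| <= CPi * normDG M v].

Definition iterates (f : E -> R) (Rf : E -> R -> \bar R) (p : Vh -> E -> R)
    (ah : Vh -> Vh -> R) (alpha : nat -> R)
    (uh : nat -> Vh) (psi : nat -> E -> R) : Prop :=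
  (forall k, broken_poly Om M 0 (psi k)) /\
  forall k, (1 <= k)%N ->
    (forall v, ah (uh k) v + (alpha k)^-1 * ip Om (p v) (psi k \- psi k.-1)
       = ip Om f (p v)) /\
    (forall w, broken_poly Om M 0 w ->
       ip Om (p (uh k)) w = ip Om (grad_Rstar Rf (psi k)) w).

Definition conforming_operator (Ch : (E -> R) -> E -> R) : Prop :=
  [/\ forall v, L2 Om v -> broken_poly Om M 1 (Ch v) /\ H10 Om (Ch v),
      forall v w, L2 Om v -> L2 Om w -> v = w %[ae leb in Om] ->
        Ch v = Ch w %[ae leb in Om],
      forall c v w, L2 Om v -> L2 Om w ->
        Ch (fun x => c * v x + w x) = (fun x => c * Ch v x + Ch w x)
          %[ae leb in Om]
    & exists B : R, forall v, L2 Om v -> normH1 Om (Ch v) <= B * normL2 Om v].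

Definition consistency_error (p : Vh -> E -> R) (ah : Vh -> Vh -> R)
    (Pi : (E -> R) -> Vh) (Ch : (E -> R) -> E -> R) (u : E -> R) : Vh -> R :=
  fun v => ah (Pi u) v - dirichlet Om u (Ch (p v)).

Definition feasibility_error (f phi : E -> R) (p : Vh -> E -> R)
    (Ch : (E -> R) -> E -> R) (u : E -> R) (w : Vh) : R :=
  inf [set `|dirichlet Om u (Ch (p w) \- v) - ip Om f (p w \- v)|
      | v in feasible Om phi].

Definition interpolation_error (f : E -> R) (p : Vh -> E -> R)
    (Pi : (E -> R) -> Vh) (Ch : (E -> R) -> E -> R) (u : E -> R) : R :=
  let Ju := p (Pi u) in `|dirichlet Om u (Ch Ju \- u) - ip Om f (Ju \- u)|.

End discretization.

(* Main.v *)
Require Import Defs.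
From HB Require Import structures.
From mathcomp Require Import all_boot all_order all_algebra.
From mathcomp Require Import all_classical all_reals all_analysis.
From mathcomp Require Import measurable_realfun lebesgue_Rintegral ess_sup_inf.
From mathcomp Require Import ring lra.

Import Order.TTheory GRing.Theory Num.Theory.
Import numFieldNormedType.Exports.
Set Implicit Arguments.
Unset Strict Implicit.
Unset Printing Implicit Defensive.

Local Open Scope classical_set_scope.
Local Open Scope ring_scope.

(** Write o^k for the gradient of R^* at psi^k, e = u_h^m - Pi_h u and
    E(v) = a_h(v, v) / 2 - (f, p v). The three point identity for D(u, o^k),
    D(u, o^{k-1}) and D(o^k, o^{k-1}) >= 0, together with the k-th equation tested with
    u_h^k - Pi_h u, gives (D(u, o^k), 1) + alpha_k (E(u_h^k) - E(Pi_h u)) <=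
    (D(u, o^{k-1}), 1). Tested with u_h^{k+1} - u_h^k, the equation shows by monotonicity
    of psi |-> o that E(u_h^k) decreases for k >= 1, so the sum over k <= m bounds
    E(u_h^m) - E(Pi_h u) = a_h(Pi_h u, e) - (f, p e) + a_h(e, e) / 2. Here a_h(Pi_h u, e)
    is the consistency error plus a(u, C_h p e); the former is absorbed by Young's
    inequality, and a(u, C_h p e) - (f, p e) is bounded below by inserting any v in K and
    using the variational inequality.

    Since the weak gradient of Defs is an arbitrary choice, the additivity of a(u, .) rests
    on the fundamental lemma of the calculus of variations. *)

(** * Integrals of nonmeasurable functions *)

(** Measurability and finiteness of the integrals of D(u, o^k) are never established, so the three
    point identity cannot simply be integrated. It enters as a pointwise bound f + h <= g a.e. with
    f, g >= 0 and only h integrable; this survives integration because the integral of a nonnegative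
    function is a supremum over simple functions. Infinite values are kept until the last lines. The
    hypotheses on psi |-> o concern bounded psi. The psi^k are piecewise constant, but boundedness
    on all of Omega requires the open cells to cover it up to a null set, hence hyperplanes to be
    null. The dual norm is a real [sup], meaningful only for a bounded functional. Finite dimension
    supplies the bound for delta_h(u), through its representer with respect to a_h. The energies
    need not decrease from u_h^0, which satisfies no equation; the sum tolerates this because the
    total weight of no steps is 0. *)

Section lower_integral.
Context d (T : measurableType d) (R : realType).
Variable mu : {measure set T -> \bar R}.
Local Open Scope ereal_scope.
Implicit Types (D : set T) (f g : T -> \bar R) (h : T -> R).
Import HBNNSimple.

Lemma ge0_integral_le_nnsfun f (c : \bar R) : (forall x, 0 <= f x) ->
  (forall s : {nnsfun T >-> R}, (forall x, (s x)%:E <= f x) ->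
     \int[mu]_x (s x)%:E <= c) ->
  \int[mu]_x f x <= c.
Proof.
move=> f0 fc; rewrite ge0_integralTE//; apply: ge_ereal_sup => _ [s /= sf <-].
have := fc s sf; rewrite integral_nnsfun// patch_setT.
by [].
Qed.

Lemma le_integral_nonmeasurable f g : (forall x, 0 <= f x) ->
  (forall x, f x <= g x) -> \int[mu]_x f x <= \int[mu]_x g x.
Proof.
move=> f0 fg; have g0 x : 0 <= g x by exact: le_trans (fg x).
rewrite !ge0_integralTE//; apply: le_ereal_sup => _ [s /= sf <-].
by exists s => // x; exact: le_trans (fg x).
Qed.

(* The integral of a nonnegative function is a supremum over the simple
   functions below it, so this holds although neither f nor g has to be
   measurable. *)
Lemma ge0_lower_integralD f g h : (forall x, 0 <= f x) -> (forall x, 0 <= g x) ->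
  mu.-integrable setT (EFin \o h) ->
  (\forall x \ae mu, f x + (h x)%:E <= g x) ->
  \int[mu]_x f x + \int[mu]_x (h x)%:E <= \int[mu]_x g x.
Proof.
move=> f0 g0 ih fhg.
have mh : measurable_fun setT h by apply/measurable_EFinP; exact: measurable_int ih.
have fih : \int[mu]_x (h x)%:E \is a fin_num by exact: integrable_fin_num.
rewrite -leeBrDr//.
apply: ge0_integral_le_nnsfun => // s sf; rewrite leeBrDr//.
case: fhg => N [mN N0 fhg].
(* [w] is measurable, dominates [s + h] everywhere and lies below [g] off [N]. It separates the two
   sides: additivity is needed only between [s], [h] and [w]. *)
pose w x := (Num.max (s x + h x) 0)%R.
have mw : measurable_fun setT w.
  by apply: measurable_maxr; [exact: measurable_funD|exact: measurable_cst].
have w0 x : (0 <= w x)%R by rewrite /w le_max lexx orbT.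
have le_w : \int[mu]_x (w x)%:E <= \int[mu]_x g x.
  have -> : \int[mu]_x (w x)%:E = \int[mu]_(x in ~` N) (w x)%:E.
    have mNC : measurable (~` N) by exact: measurableC.
    rewrite -(setUv N) ge0_integral_setU//=.
    - rewrite [X in X + _](_ : _ = 0) ?add0e//.
      by apply: null_set_integral => //; apply/measurable_EFinP;
        exact: measurable_funTS.
    - by rewrite setUv; apply/measurable_EFinP.
    - by move=> x _; rewrite lee_fin.
    - by apply/disj_setPS; rewrite setICr.
  rewrite integral_mkcond; apply: le_integral_nonmeasurable => x.
    by rewrite /patch; case: ifP => //; rewrite lee_fin.
  rewrite /patch; case: ifPn => // /set_mem Nx.
  have [fhgx|fhgx] := pselect (f x + (h x)%:E <= g x); last first.
    by exfalso; apply: Nx; exact: fhg.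
  rewrite /w /Num.max; case: ifPn => // _.
  by apply: le_trans fhgx; rewrite EFinD leeD2r.
apply: le_trans le_w.
have [wy|wfin] := eqVneq (\int[mu]_x (w x)%:E) +oo.
  by rewrite wy; case: (\int[mu]_x (h x)%:E) fih => //= r _; rewrite leey.
have iw : mu.-integrable setT (EFin \o w).
  apply/integrableP; split; first exact/measurable_EFinP.
  under eq_integral do rewrite gee0_abs ?lee_fin//.
  by rewrite ltey.
rewrite -leeBrDr// -integralB_EFin//.
apply: ge0_le_integral => //.
- by move=> x _; rewrite lee_fin.
- exact/measurable_EFinP.
- by apply/measurable_EFinP; exact: measurable_funB.
- by move=> x _; rewrite -EFinB lee_fin lerBrDr /w le_max lexx.
Qed.

Lemma ge0_ae_eq_lower_integral f g : (forall x, 0 <= f x) -> (forall x, 0 <= g x) ->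
  (\forall x \ae mu, f x = g x) -> \int[mu]_x f x = \int[mu]_x g x.
Proof.
have H f' g' : (forall x, 0 <= f' x) -> (forall x, 0 <= g' x) ->
    (\forall x \ae mu, f' x = g' x) -> \int[mu]_x f' x <= \int[mu]_x g' x.
  move=> f0 g0 fg; rewrite -[leLHS]adde0 -(integral0 mu setT).
  apply: (@ge0_lower_integralD _ _ (cst 0%R)) => //; first exact: integrable0.
  by apply: filterS fg => x ->; rewrite adde0.
move=> f0 g0 fg; apply/eqP; rewrite eq_le !H//.
by apply: filterS fg => x ->.
Qed.

(** As no measurability is assumed, any integrand may be changed on a null set, in particular
    Bregman divergences and arbitrary representatives. *)
Lemma ae_eq_lower_integral D f g : (\forall x \ae mu, D x -> f x = g x) ->
  \int[mu]_(x in D) f x = \int[mu]_(x in D) g x.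
Proof.
move=> fg; rewrite !(integral_mkcond D) integralE [RHS]integralE.
congr (_ - _); apply: ge0_ae_eq_lower_integral => //; apply: filterS fg => x fg;
  by rewrite ?funeposE ?funenegE /patch; case: ifPn => // /set_mem/fg ->.
Qed.

End lower_integral.

(** * The L2 inner product *)

Section L2_inner_product.
Context {R : realType} {n : nat}.
Local Notation E := 'rV[R]_n.
Local Notation leb := (lebesgue R n).
Implicit Types (D : set E) (v w z : E -> R) (c : R).

Lemma L2_lin D c v w : L2 D v -> L2 D w -> L2 D (fun x => c * v x + w x).
Proof.
move=> Lv Lw; rewrite /L2.
rewrite (_ : _ \_ D = c *: (v \_ D) + w \_ D); last first.
  apply/funext => x; rewrite /= fctE (_ : (c *: _) x = c * (v \_ D) x)// /patch.
  by case: ifP => // _; rewrite mulr0 addr0.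
have [_ L] := @Lfun_submod_closed _ _ _ leb 2%:E (lee1n 2).
exact: L.
Qed.

Lemma L2B D v w : L2 D v -> L2 D w -> L2 D (v \- w).
Proof.
move=> Lv Lw; have := L2_lin (-1) Lw Lv.
by under [X in L2 _ X -> _]eq_fun do rewrite mulN1r addrC.
Qed.

Lemma measurable_L2 D v : L2 D v -> measurable_fun setT (v \_ D).
Proof. by move=> /andP[]; rewrite inE. Qed.

Lemma mul_patch D v w : (v \* w) \_ D = (v \_ D) \* (w \_ D).
Proof. by apply/funext => x; rewrite /patch /=; case: ifP; rewrite ?mulr0. Qed.

Lemma ip_integrable D v w : L2 D v -> L2 D w ->
  leb.-integrable setT (EFin \o (v \* w) \_ D).
Proof.
by move=> Lv Lw; rewrite mul_patch; apply/Lfun1_integrable; exact: Lfun2_mul_Lfun1.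
Qed.

Lemma ipE D v w : ip D v w = \int[leb]_x ((v \* w) \_ D) x.
Proof. by rewrite /ip Rintegral_mkcond. Qed.

Lemma ipC D v w : ip D v w = ip D w v.
Proof. by rewrite /ip; under eq_Rintegral do rewrite mulrC. Qed.

Lemma ip_ae D v v' w w' : v = v' %[ae leb in D] -> w = w' %[ae leb in D] ->
  ip D v w = ip D v' w'.
Proof.
move=> vv ww; congr fine; apply: ae_eq_lower_integral.
by apply: filterS2 vv ww => x vv ww Dx; rewrite vv// ww.
Qed.

Lemma ip_linl D c v w z : L2 D v -> L2 D w -> L2 D z ->
  ip D (fun x => c * v x + w x) z = c * ip D v z + ip D w z.
Proof.
move=> Lv Lw Lz; rewrite !ipE -RintegralZl//; last exact: ip_integrable.
rewrite -RintegralD//; last 2 first.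
- have := integrableZl (mu := leb) measurableT c (ip_integrable Lv Lz).
  by under [X in integrable _ _ X -> _]eq_fun do rewrite /= -EFinM.
- exact: ip_integrable.
apply: eq_Rintegral => x _; rewrite /patch; case: ifP => _; last by rewrite mulr0 addr0.
by rewrite /= mulrDl mulrA.
Qed.

Lemma ip_linr D c v w z : L2 D v -> L2 D w -> L2 D z ->
  ip D z (fun x => c * v x + w x) = c * ip D z v + ip D z w.
Proof. by move=> *; rewrite ipC ip_linl// !(ipC D z). Qed.

Lemma ipBl D v w z : L2 D v -> L2 D w -> L2 D z ->
  ip D (v \- w) z = ip D v z - ip D w z.
Proof.
move=> Lv Lw Lz; have := ip_linl (-1) Lw Lv Lz.
under [X in ip _ X _ = _ -> _]eq_fun do rewrite mulN1r addrC.
by rewrite mulN1r addrC.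
Qed.

Lemma ipBr D v w z : L2 D v -> L2 D w -> L2 D z ->
  ip D z (v \- w) = ip D z v - ip D z w.
Proof. by move=> *; rewrite ipC ipBl// !(ipC D z). Qed.

Lemma weak_gradientP D v : H1 D v -> is_weak_gradient D v (weak_gradient D v).
Proof. by case=> _ [G HG]; rewrite /weak_gradient; case: xgetP => // /(_ G). Qed.

Lemma L2_weak_gradient D v i : H1 D v -> L2 D (fun x => weak_gradient D v x 0 i).
Proof. by case/weak_gradientP. Qed.

(** Both functions have the same set of weak gradients, so [xget] selects literally the same
    element. *)
Lemma eq_weak_gradient D v w : v = w %[ae leb in D] ->
  weak_gradient D v = weak_gradient D w.
Proof.
move=> vw; rewrite /weak_gradient; congr xget; apply/funext => G; apply/propext.
by split=> -[LG HG]; split=> // i t tt; rewrite -(HG i t tt); apply: ip_ae;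
  try (by exact/nearW); apply: filterS vw => x xvw Dx; rewrite xvw.
Qed.

Lemma Rintegral_sum (I : Type) (r : seq I) (F : I -> E -> R) :
  (forall i, leb.-integrable setT (EFin \o F i)) ->
  \int[leb]_x (\sum_(i <- r) F i x) = \sum_(i <- r) \int[leb]_x F i x /\
  leb.-integrable setT (EFin \o (fun x => \sum_(i <- r) F i x)).
Proof.
move=> iF; elim: r => [|i r [IH1 IH2]].
  rewrite big_nil; split.
    under eq_Rintegral do rewrite big_nil.
    by rewrite Rintegral_cst// mul0r.
  rewrite (_ : _ \o _ = cst 0%E); first exact: integrable0.
  by apply/funext => x /=; rewrite big_nil.
rewrite big_cons; split.
  by under eq_Rintegral do rewrite big_cons; rewrite RintegralD// IH1.
have := integrableD measurableT (iF i) IH2; apply: eq_integrable => // x _ /=.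
by rewrite big_cons.
Qed.

Lemma dirichletE D w v : H1 D w -> H1 D v ->
  dirichlet D w v =
  \sum_i ip D (fun x => weak_gradient D w x 0 i) (fun x => weak_gradient D v x 0 i).
Proof.
move=> Hw Hv; rewrite /dirichlet Rintegral_mkcond.
under [RHS]eq_bigr do rewrite ipE.
have H i := ip_integrable (L2_weak_gradient i Hw) (L2_weak_gradient i Hv).
have [<- _] := Rintegral_sum (index_enum _) H.
apply: eq_Rintegral => x _; rewrite /patch; case: ifPn => // _.
by rewrite big1.
Qed.

End L2_inner_product.

(** * Smooth cut-off functions *)

Section flat_function.
Context {R : realType}.
Implicit Types (p : {poly R}) (f : R -> R).

(** [F] is the whole tower of derivatives, which makes closure under affine substitution a direct
    rescaling. *)
Definition smooth1 f : Prop := exists F : nat -> R -> R,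
  F 0%N = f /\ forall k (s : R), is_derive s (1 : R) (F k) (F k.+1 s).

(** The classical smooth function exp(-1/s), extended by 0. The polynomial factor in 1/s makes the
    family closed under differentiation. *)
Definition flat p (s : R) : R := if 0 < s then p.[s^-1] * expR (- s^-1) else 0.

Definition flat_deriv p : {poly R} := 'X^2 * (p - p^`()).

(** Quadratic decay makes the difference quotient at 0 vanish. For the monomial of degree i, exp(y)
    >= y^(i+2) / (i+2)! at y = 1/s absorbs the power of y and leaves s^2. *)
Lemma flat_bound p : exists2 C, 0 <= C & forall s, `|flat p s| <= C * s ^+ 2.
Proof.
exists (\sum_(i < size p) `|p`_i| * (i.+2)`!%:R).
  by apply: sumr_ge0 => i _; rewrite mulr_ge0.
move=> s; rewrite /flat; case: ifPn => [s0|_]; last first.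
  by rewrite normr0 mulr_ge0 ?sqr_ge0//; apply: sumr_ge0 => i _; rewrite mulr_ge0.
rewrite horner_coef normrM (ger0_norm (expR_ge0 _)).
rewrite (@le_trans _ _ (\sum_(i < size p) `|p`_i| * (s^-1 ^+ i * expR (- s^-1))))//.
  under [leRHS]eq_bigr do rewrite mulrA.
  rewrite -mulr_suml ler_wpM2r ?expR_ge0//.
  rewrite (le_trans (ler_norm_sum _ _ _))//; apply: ler_sum => i _.
  by rewrite normrM normrX (@ger0_norm _ s^-1)// invr_ge0 ltW.
rewrite mulr_suml; apply: ler_sum => i _; rewrite -mulrA ler_wpM2l//.
rewrite expRN ler_pdivrMr ?expR_gt0//.
have := @expR_ge1Dxn R s^-1 i.+1 (ltW _); rewrite invr_gt0 => /(_ s0) H.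
apply: (@le_trans _ _ ((i.+2)`!%:R * s ^+ 2 * (s^-1 ^+ i.+2 / (i.+2)`!%:R))).
  rewrite !exprSr; have q0 : (i.+2)`!%:R != 0 :> R by rewrite pnatr_eq0 -lt0n fact_gt0.
  have s_neq0 : s != 0 by rewrite gt_eqF.
  move: (i.+2)`!%:R (s^-1 ^+ i) q0 => q y q0.
  by rewrite le_eqVlt; apply/orP; left; apply/eqP; field; rewrite q0.
rewrite ler_wpM2l ?mulr_ge0 ?sqr_ge0 ?(ltW s0)//.
by apply: le_trans H; rewrite lerDr.
Qed.

Lemma is_derive_flat p (s : R) : is_derive s (1 : R) (flat p) (flat (flat_deriv p) s).
Proof.
have [s0|s0|<-] := ltgtP 0 s.
- have near_s : \forall t \near s, p.[t^-1] * expR (- t^-1) = flat p t.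
    near=> t; rewrite /flat ifT//; near: t; exact: lt_nbhsr.
  apply: (near_eq_is_derive near_s).
  have s_neq0 : s != 0 by rewrite gt_eqF.
  have d1 : is_derive s 1 (fun t : R => t^-1) (- s ^- 2).
    by have := is_deriveV s_neq0 (is_derive_id s (1 : R)); rewrite scaler1.
  have dp : is_derive s^-1 1 (horner p) p^`().[s^-1].
    by apply: DeriveDef; [exact: derivable_horner|rewrite derivE derive1E].
  have d2 : is_derive s 1 (fun t : R => p.[t^-1]) (p^`().[s^-1] * (- s ^- 2)).
    exact: is_derive1_comp.
  have d3 : is_derive s 1 (fun t : R => expR (- t^-1)) (expR (- s^-1) * s ^- 2).
    have d3' : is_derive s 1 (fun t : R => - t^-1) (s ^- 2).
      by apply: is_derive_eq; rewrite opprK.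
    exact: (@is_derive1_comp _ expR).
  apply: is_derive_eq.
  rewrite /flat s0 /flat_deriv !hornerE /= /GRing.scale /=.
  by rewrite exprVn; ring.
- have near_s : \forall t \near s, (cst 0 : R -> R) t = flat p t.
    near=> t; rewrite /flat ifF//; apply/negbTE; rewrite -leNgt ltW//.
    near: t; exact: lt_nbhsl.
  apply: (near_eq_is_derive near_s); rewrite /flat ifF; last first.
    by apply/negbTE; rewrite -leNgt ltW.
  exact: is_derive_cst.
- have flat0 q : flat q 0 = 0 by rewrite /flat ltxx.
  rewrite flat0.
  have [C C0 HC] := flat_bound p.
  suff H : h^-1 *: ((flat p \o shift 0) (h *: (1 : R)) - flat p 0) @[h --> 0^'] --> (0 : R).
    by apply: DeriveDef; [apply/cvg_ex; exists 0|exact: cvg_lim H].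
  apply/cvgr0Pnorm_le => e e0; near=> h.
  rewrite /= flat0 subr0 addr0 /GRing.scale /= mulr1 normrM normfV.
  have h0 : h != 0 by near: h; exact: nbhs_dnbhs_neq.
  rewrite ler_pdivrMl ?normr_gt0//.
  rewrite (le_trans (HC h))// -(real_normK (num_real h)) expr2 mulrCA ler_wpM2l//.
  rewrite (@le_trans _ _ ((C + 1) * `|h|))// ?ler_wpM2r ?lerDl//.
  rewrite -ler_pdivlMl; last by rewrite ltr_wpDl.
  by near: h; apply: dnbhs0_le; rewrite mulr_gt0// invr_gt0 ltr_wpDl.
Unshelve. all: by end_near.
Qed.

Lemma smooth1_flat p : smooth1 (flat p).
Proof.
exists (fun k => flat (iter k flat_deriv p)); split=> // k s /=.
exact: is_derive_flat.
Qed.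

Lemma smooth1_affine f a b : smooth1 f -> smooth1 (fun s => f (a * s + b)).
Proof.
move=> [F [<- HF]]; exists (fun k s => a ^+ k * F k (a * s + b)); split.
  by apply/funext => s; rewrite expr0 mul1r.
move=> k s.
have d1 : is_derive s 1 (fun t : R => a * t + b) a.
  have -> : (fun t : R => a * t + b) = a *: (id : R -> R) + cst b by [].
  by apply: is_derive_eq; rewrite addr0 scaler1.
have d2 : is_derive s 1 (fun t : R => F k (a * t + b)) (F k.+1 (a * s + b) * a).
  exact: (@is_derive1_comp _ (F k)).
have -> : (fun t : R => a ^+ k * F k (a * t + b)) =
  a ^+ k *: (fun t : R => F k (a * t + b)) by [].
by apply: is_derive_eq; rewrite /GRing.scale /= exprSr; ring.
Qed.

End flat_function.

(** * Smooth functions of several variables and bumps supported in boxes *)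

Section smooth_functions.
Context {R : realType} {n : nat}.
Local Notation E := 'rV[R]_n.
Implicit Types (v w : E -> R) (a b : E).

Lemma smooth_continuous v : smooth v -> continuous v.
Proof. by move/(_ 0%N). Qed.

Lemma smooth_partial v i : smooth v -> smooth (partial i v).
Proof. by move=> sv k; have [_] := sv k.+1 i. Qed.

Lemma smooth_derivable v i x : smooth v -> derivable v x (delta_mx 0 i).
Proof. by move=> sv; have [+ _] := sv 1%N i; exact. Qed.

Lemma CkD k v w : Ck k v -> Ck k w -> Ck k (v + w).
Proof.
elim: k v w => [|k IH] v w /=.
  by move=> cv cw x; exact: (continuousD (cv x) (cw x)).
move=> Cv Cw i; have [dv Cdv] := Cv i; have [dw Cdw] := Cw i.
split; first by move=> x; exact: derivableD.
rewrite (_ : partial i (v + w) = partial i v + partial i w); first exact: IH.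
by apply/funext => x; rewrite /partial deriveD.
Qed.

Lemma smoothM v w : smooth v -> smooth w -> smooth (v * w).
Proof.
move=> + + k; elim: k v w => [|k IH] v w /= sv sw.
  by move=> x; apply: continuousM; exact: smooth_continuous.
move=> i; have dv x := @smooth_derivable v i x sv.
have dw x := @smooth_derivable w i x sw.
split; first by move=> x; exact: derivableM.
rewrite (_ : partial i (v * w) = v * partial i w + w * partial i v).
  by apply: CkD; apply: IH => //; exact: smooth_partial.
by apply/funext => x; rewrite /partial deriveM.
Qed.

Lemma smooth_cst (c : R) : smooth (cst c : E -> R).
Proof.
move=> k; elim: k c => [|k IH] c /=; first by move=> x; exact: cst_continuous.
move=> i; split; first by move=> x; exact: derivable_cst.
rewrite (_ : partial i _ = cst 0)//.
by apply/funext => x; rewrite /partial derive_cst.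
Qed.

Lemma is_derive_coord (f : R -> R) (df : R) (x : E) i j :
  is_derive (x 0 i) (1 : R) f df ->
  is_derive x (delta_mx 0 j : E) (fun y : E => f (y 0 i)) ((i == j)%:R * df).
Proof.
move=> [fd fv]; set g := fun y : E => f (y 0 i).
have gE (h : R) : g (h *: (delta_mx 0 j : E) + x) = f (h *: (i == j)%:R + x 0 i).
  by rewrite /g !mxE eqxx /=.
have [ij|ij] := eqVneq i j.
  rewrite mul1r; have qE : (fun h : R => h^-1 *: ((g \o shift x) (h *: delta_mx 0 j) - g x)) =
      (fun h : R => h^-1 *: ((f \o shift (x 0 i)) (h *: (1 : R)) - f (x 0 i))).
    by apply/funext => h /=; rewrite gE -ij eqxx.
  by apply: DeriveDef; [rewrite /derivable qE|rewrite /derive qE].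
rewrite mul0r.
have qE : (fun h : R => h^-1 *: ((g \o shift x) (h *: delta_mx 0 j) - g x)) = cst 0.
  by apply/funext => h /=; rewrite gE (negbTE ij) scaler0 add0r subrr scaler0.
apply: DeriveDef; rewrite /derivable /derive qE; first exact: is_cvg_cst.
by apply: cvg_lim => //; exact: cvg_cst.
Qed.

Lemma smooth_coord (f : R -> R) i : smooth1 f -> smooth (fun x : E => f (x 0 i)).
Proof.
move=> [F [<- HF]] k.
(* The factor [c] absorbs the Kronecker delta that each partial derivative produces. *)
suff H c m : Ck k (fun x : E => c * F m (x 0 i)).
  by have := H 1 0%N; under [X in Ck _ X -> _]eq_fun do rewrite mul1r.
elim: k c m => [|k IH] c m /=.
  move=> x; apply: continuousM; first exact: cst_continuous.
  apply: (@continuous_comp _ _ _ (fun y : E => y 0 i) (F m)).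
    exact: coord_continuous.
  by apply/differentiable_continuous/derivable1_diffP; case: (HF m (x 0 i)).
move=> j; have d x : is_derive x (delta_mx 0 j : E) (fun y : E => c * F m (y 0 i))
    (c * ((i == j)%:R * F m.+1 (x 0 i))).
  by have dF := is_derive_coord j (HF m (x 0 i)); exact: is_deriveZ.
split; first by move=> x; case: (d x).
rewrite (_ : partial _ _ = fun x : E => (c * (i == j)%:R) * F m.+1 (x 0 i))//.
by apply/funext => x; rewrite /partial (@derive_val _ _ _ _ _ _ _ (d x)) mulrA.
Qed.

Lemma smooth_prod (I : Type) (r : seq I) (F : I -> E -> R) :
  (forall i, smooth (F i)) -> smooth (fun x => \prod_(i <- r) F i x).
Proof.
move=> sF; elim: r => [|i r IH].
  by under [X in smooth X]eq_fun do rewrite big_nil; exact: smooth_cst.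
under [X in smooth X]eq_fun do rewrite big_cons.
exact: smoothM.
Qed.

(* These tend to the indicator function of ]a, b[ while keeping their support. *)
Definition bump1 (a b : R) (k : nat) (s : R) : R :=
  flat 1 (k.+1%:R * s + - (k.+1%:R * a)) * flat 1 (- k.+1%:R * s + k.+1%:R * b).

Definition bump a b k (x : E) : R := \prod_i bump1 (a 0 i) (b 0 i) k (x 0 i).

Definition box a b : set E := [set x | forall i, a 0 i < x 0 i < b 0 i].

Definition closed_box a b : set E := [set x | forall i, a 0 i <= x 0 i <= b 0 i].

Lemma smooth_bump a b k : smooth (bump a b k).
Proof.
apply: smooth_prod => i.
exact: (smoothM (smooth_coord i (smooth1_affine _ _ (smooth1_flat 1)))
  (smooth_coord i (smooth1_affine _ _ (smooth1_flat 1)))).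
Qed.

Lemma flat1_ge0 (s : R) : 0 <= flat 1 s.
Proof. by rewrite /flat; case: ifP => // _; rewrite hornerC mul1r expR_ge0. Qed.

Lemma flat1_le1 (s : R) : flat 1 s <= 1.
Proof.
rewrite /flat; case: ifP => // s0.
by rewrite hornerC mul1r -[leRHS]expR0 ler_expR oppr_le0 invr_ge0 ltW.
Qed.

Lemma flat1_le0 (s : R) : s <= 0 -> flat 1 s = 0.
Proof. by rewrite /flat leNgt => /negbTE ->. Qed.

Lemma bump1_out (a b : R) k s : ~~ (a < s < b) -> bump1 a b k s = 0.
Proof.
have k0 : 0 <= k.+1%:R :> R by [].
rewrite negb_and -!leNgt /bump1 => /orP[sa|bs].
  by rewrite flat1_le0 ?mul0r// subr_le0 ler_wpM2l.
by rewrite mulrC flat1_le0 ?mul0r// mulNr addrC subr_le0 ler_wpM2l.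
Qed.

Lemma bump1_itv (a b : R) k s : 0 <= bump1 a b k s <= 1.
Proof.
rewrite /bump1 mulr_ge0 ?flat1_ge0//=.
by rewrite -[leRHS]mulr1 ler_pM ?flat1_ge0 ?flat1_le1.
Qed.

Lemma cvg_flat1 (c : R) : 0 < c -> flat 1 (k.+1%:R * c) @[k --> \oo] --> (1 : R).
Proof.
move=> c0; have -> : (fun k => flat 1 (k.+1%:R * c)) =
    (fun k => expR (- (c^-1 * k.+1%:R^-1))).
  by apply/funext => k; rewrite /flat mulr_gt0// hornerC mul1r invfM mulrC.
rewrite -[X in _ --> X]expR0; apply: continuous_cvg; first exact: continuous_expR.
rewrite -[X in _ --> X]oppr0; apply: cvgN; rewrite -[X in _ --> X](mulr0 c^-1).
by apply: cvgMr; exact: cvg_harmonic.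
Qed.

Lemma cvg_bump1 (a b s : R) : a < s < b -> bump1 a b k s @[k --> \oo] --> (1 : R).
Proof.
move=> /andP[sa bs]; rewrite -[X in _ --> X]mulr1; apply: cvgM.
  under eq_fun do rewrite -mulrBr; apply: cvg_flat1; lra.
under eq_fun do rewrite mulNr addrC -mulrBr; apply: cvg_flat1; lra.
Qed.

Lemma bump_itv a b k x : 0 <= bump a b k x <= 1.
Proof.
rewrite prodr_ge0/=; last by move=> i _; have /andP[] := bump1_itv (a 0 i) (b 0 i) k (x 0 i).
by apply: prodr_ile1 => i _; exact: bump1_itv.
Qed.

Lemma bump_out a b k x : ~ box a b x -> bump a b k x = 0.
Proof.
move=> /existsNP[i /negP xi]; rewrite /bump (bigD1 i)//= bump1_out// mul0r.
by [].
Qed.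

Lemma cvg_bump a b x : box a b x -> bump a b k x @[k --> \oo] --> (1 : R).
Proof.
move=> abx; rewrite /bump; elim: (index_enum _) => [|i r IH].
  by under eq_fun do rewrite big_nil; exact: cvg_cst.
under eq_fun do rewrite big_cons.
have := cvgM (cvg_bump1 (abx i)) IH; rewrite mulr1; exact.
Qed.

Lemma compact_closed_box a b : compact (closed_box a b).
Proof.
have := @rV_compact _ n (fun i => `[a 0 i, b 0 i]%classic) (fun i => @segment_compact R _ _).
by congr compact; apply/seteqP; split => x /= xab i; have := xab i; rewrite in_itv.
Qed.

Lemma test_function_bump (D : set E) a b k :
  closed_box a b `<=` D -> test_function D (bump a b k).
Proof.
move=> abD; have cab := @compact_closed_box a b.
have sub : closure [set x | bump a b k x != 0] `<=` closed_box a b.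
  have /closure_id -> : closed (closed_box a b).
    by apply: compact_closed => //; exact: norm_hausdorff.
  apply: closureS => x /= /eqP x0 i.
  have [abx|abx] := pselect (box a b x); last by rewrite bump_out in x0.
  by have /andP[ax xb] := abx i; rewrite !ltW.
split; [exact: smooth_bump| |exact: subset_trans abD].
by apply: subclosed_compact cab sub; exact: closed_closure.
Qed.

End smooth_functions.

(** * Boxes *)

Section boxes.
Context {R : realType}.

Definition upper n (c : 'rV[R]_n) : set 'rV[R]_n := [set x | forall i, c 0 i < x 0 i].

Lemma measurable_coord_itv n i (J : interval R) :
  measurable [set x : 'rV[R]_n | x 0 i \in J].
Proof.
have := measurable_coord i measurableT (measurable_itv J : measurable ([set` J] : set (measurableTypeR R))).
by rewrite setTI.
Qed.

Lemma measurable_box n (a b : 'rV[R]_n) : measurable (box a b).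
Proof.
rewrite (_ : box a b = \bigcap_(i in setT) [set x | x 0 i \in `]a 0 i, b 0 i[]).
  by apply: fin_bigcap_measurable => // i _; exact: measurable_coord_itv.
apply/seteqP; split => [x abx i _ /=|x abx i]; first by rewrite in_itv /= abx.
by have := abx i I; rewrite /= in_itv.
Qed.

Lemma measurable_upper n (c : 'rV[R]_n) : measurable (upper c).
Proof.
rewrite (_ : upper c = \bigcap_(i in setT) [set x | x 0 i \in `]c 0 i, +oo[]).
  by apply: fin_bigcap_measurable => // i _; exact: measurable_coord_itv.
apply/seteqP; split => [x abx i _ /=|x abx i]; first by rewrite in_itv /= andbT abx.
by have := abx i I; rewrite /= in_itv /= andbT.
Qed.

(** The orthants are chosen because they are stable under intersection, as Dynkin's lemma requires,
    and cut boxes into boxes. *)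
Lemma measurable_rVE n : @measurable _ 'rV[R]_n = <<s range (@upper n) >>.
Proof.
apply/seteqP; split; last first.
  apply: smallest_sub; first exact: sigma_algebra_measurable.
  by move=> _ [c _ <-]; exact: measurable_upper.
apply: smallest_sub; first exact: smallest_sigma_algebra.
move=> A; rewrite -bigcup_seq /= => -[i _ [B mB <-]].
have m_i : measurable_fun (setT : set (g_sigma_algebraType (range (@upper n))))
    (@rV_coord R n i : g_sigma_algebraType (range (@upper n)) -> measurableTypeR R).
  apply: (measurability _ (RGenOInfty.measurableE R)) => _ [_ [c ->] <-].
  (* A half-space bounding one coordinate is the union of the orthants whose other corner
     coordinates are [- k%:R]. *)
  rewrite setTI (_ : _ @^-1` _ =
    \bigcup_k upper (\row_j (if j == i then c else - k%:R))).
    apply: bigcup_measurable => k _; apply: sub_sigma_algebra.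
    by exists (\row_j (if j == i then c else - k%:R)).
  apply/seteqP; split => [x /=|x [k _ xk]].
    rewrite in_itv /= andbT => cx.
    have [k xk] : exists k : nat, forall j, - k%:R < x 0 j.
      exists (Num.truncn (\sum_j `|x 0 j|)).+1 => j.
      rewrite ltrNl (le_lt_trans (ler_norm _))// normrN.
      apply: le_lt_trans (truncnS_gt _).
      by rewrite (bigD1 j)//= lerDl sumr_ge0.
    by exists k => // j; rewrite mxE; case: eqP => [->|].
  by rewrite /= in_itv /= andbT; have := xk i; rewrite mxE eqxx.
exact: m_i.
Qed.

Lemma cons_rV_lshift n (p : measurableTypeR R * 'rV[R]_n) :
  cons_rV p 0 (lshift n 0 : 'I_(1 + n)) = p.1.
Proof. by apply: (etrans (@row_mxEl _ 1 1 n _ _ 0 0)); rewrite mxE eqxx. Qed.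

Lemma cons_rV_rshift n (p : measurableTypeR R * 'rV[R]_n) j :
  cons_rV p 0 (rshift 1 j : 'I_(1 + n)) = p.2 0 j.
Proof. exact: (@row_mxEr _ 1 1 n). Qed.

Lemma lebesgue_box n (a b : 'rV[R]_n) : (lebesgue R n (box a b) < +oo)%E.
Proof.
elim: n a b => [|n IH] a b /=; first by rewrite /dirac indicE ltry.
rewrite /lebesgue_step /pushforward.
have -> : cons_rV @^-1` box a b =
    `]a 0 (lshift n 0 : 'I_(1 + n)), b 0 (lshift n 0 : 'I_(1 + n))[%classic `*`
    box (\row_j a 0 (rshift 1 j)) (\row_j b 0 (rshift 1 j)).
  apply/seteqP; split => p /=.
    move=> abp; split; first by rewrite /= in_itv /= -cons_rV_lshift; exact: abp.
    by move=> j; rewrite !mxE -cons_rV_rshift; exact: abp.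
  rewrite in_itv /= => -[p1 p2] i; case: (@split_ordP 1 n i) => j ->.
    by rewrite ord1 cons_rV_lshift.
  by rewrite cons_rV_rshift; have := p2 j; rewrite !mxE.
rewrite product_measure1E//; last exact: measurable_box.
rewrite lte_mul_pinfty//.
- have L (u v : R) : (lebesgue_measure (`]u, v[%classic : set R) < +oo)%E.
    by rewrite lebesgue_measure_itv /=; case: ifP => _; rewrite -?EFinB ltry.
  by rewrite ge0_fin_numE//; exact: L.
Qed.

Lemma box_upper n (a b c : 'rV[R]_n) :
  box a b `&` upper c = box (\row_i Num.max (a 0 i) (c 0 i)) b.
Proof.
apply/seteqP; split => [x [abx cx] i|x abx]; last split=> i.
- by rewrite mxE gt_max cx andbT abx.
- by have := abx i; rewrite mxE gt_max => /andP[/andP[-> _] ->].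
- by have := abx i; rewrite mxE gt_max => /andP[/andP[_ ->] _].
Qed.

(** The boxes in the hypothesis are the intersections of [box a b] with orthants, and [c = a] gives
    back the whole box. Dynkin's lemma carries the vanishing of the integrals over to all measurable
    subsets. *)
Lemma integral_boxes_eq0 n (a b : 'rV[R]_n) (g : 'rV[R]_n -> \bar R) :
  (lebesgue R n).-integrable (box a b) g ->
  (forall c : 'rV[R]_n, \int[lebesgue R n]_(x in box (\row_i Num.max (a 0 i) (c 0 i))%R b) g x = 0)%E ->
  \forall x \ae lebesgue R n, box a b x -> g x = 0%E.
Proof.
move=> ig g0; have mQ := measurable_box a b.
have mg := measurable_int _ ig.
have H A : measurable A -> (\int[lebesgue R n]_(x in box a b `&` A) g x = 0)%E.
  rewrite {1}measurable_rVE.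
  move: A; apply: dynkin_induction.
  - exact: measurable_rVE.
  - move=> _ _ [c _ <-] [d _ <-]; exists (\row_i Num.max (c 0 i) (d 0 i)) => //.
    apply/seteqP; split => [x cdx|x [cx dx] i].
      by split=> i; have := cdx i; rewrite mxE gt_max => /andP[].
    by rewrite mxE gt_max cx dx.
  - rewrite setIT.
    have := g0 a; rewrite (_ : (\row_i _) = a)//.
    by apply/rowP => i; rewrite mxE maxxx.
  - by move=> _ [c _ <-]; rewrite /= box_upper g0.
  - move=> S mS S0.
    have := @integral_setU _ _ _ (lebesgue R n) (box a b `&` S) (box a b `&` ~` S) g.
    rewrite -setIUr setUv setIT S0 add0e => <-//.
    + have := g0 a; rewrite (_ : (\row_i _) = a)//.
      by apply/rowP => i; rewrite mxE maxxx.
    + exact: measurableI.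
    + by apply: measurableI => //; exact: measurableC.
    + by apply/disj_setPS; rewrite setIACA setICr setI0.
  - move=> F mF tF F0; rewrite setI_bigcupr integral_bigcup.
    + by rewrite eseries0.
    + exact: trivIset_setIl.
    + by move=> k; exact: measurableI.
    + apply: integrableS ig => //; last by rewrite -setI_bigcupr; exact: subIsetl.
      by apply: bigcupT_measurable => k; exact: measurableI.
have := @integral_ae_eq _ _ _ (lebesgue R n) (box a b) mQ (cst 0%E) g ig.
move=> /(_ (measurable_cst _)); apply => A AQ mA.
by rewrite integral0 -(H A mA) setIidr.
Qed.

End boxes.

(** * The fundamental lemma of the calculus of variations *)

Section fundamental_lemma.
Context {R : realType} {n : nat}.
Local Notation E := 'rV[R]_n.
Local Notation leb := (lebesgue R n).
Implicit Types (D : set E) (g v w : E -> R).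

Lemma sub_box (a b : E) : box a b `<=` closed_box a b.
Proof. by move=> x abx i; have /andP[? ?] := abx i; rewrite !ltW. Qed.

Lemma L2_integrable_box D g a b : L2 D g -> leb.-integrable (box a b) (EFin \o g \_ D).
Proof.
move=> Lg; have mQ := measurable_box a b; have mg := measurable_L2 Lg.
apply: (@le_integrable _ _ _ _ _ _ _ (EFin \o (fun x => 1 + (g \_ D) x ^+ 2))) => //.
- by apply/measurable_EFinP; exact: measurable_funTS.
- move=> x _ /=; rewrite lee_fin (@ger0_norm _ (1 + _)) ?addr_ge0 ?sqr_ge0//.
  rewrite -(real_normK (num_real ((g \_ D) x))).
  by move: `|_| => y; nra.
- apply: (@integrableD _ _ _ _ _ mQ (cst 1%E) (EFin \o (fun x => (g \_ D) x ^+ 2))).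
    apply/integrableP; split=> //.
    under eq_integral do rewrite /= normr1.
    by rewrite integral_cst// mul1e; exact: lebesgue_box.
  by apply: integrableS (Lfun2_integrable_sqr Lg).
Qed.

Lemma measurable_bump a b k : measurable_fun setT (bump a b k : E -> R).
Proof.
apply: measurable_prod => i _.
have mflat c d : measurable_fun setT (fun x : E => flat 1 (c * x 0 i + d)).
  apply: (@measurableT_comp _ _ _ _ _ _ (fun s : R => flat 1 (c * s + d)) _
    (@rV_coord R n i)); last exact: measurable_coord.
  apply: continuous_measurable_fun => s.
  have [F [<- HF]] := smooth1_affine c d (smooth1_flat (1 : {poly R})).
  by apply/differentiable_continuous/derivable1_diffP; case: (HF 0%N s).
exact: (measurable_funM (mflat _ _) (mflat _ _)).
Qed.

(** The bumps are admissible tests as the closed box lies in [D]. They are bounded by 1 and tend to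
    1 on the open box, so dominated convergence applies. *)
Lemma integral_box_eq0 D g a b : L2 D g ->
  (forall t, test_function D t -> ip D g t = 0) -> closed_box a b `<=` D ->
  (\int[leb]_(x in box a b) ((g \_ D) x)%:E = 0)%E.
Proof.
move=> Lg g0 abD; have mQ := measurable_box a b; have mg := measurable_L2 Lg.
have ig := L2_integrable_box a b Lg.
have mt := measurable_bump a b.
pose F k x := ((g \_ D) x * bump a b k x)%:E.
have mF k : measurable_fun setT (F k).
  by apply/measurable_EFinP; exact: measurable_funM.
have leF k x : (`|F k x| <= `|(g \_ D) x|%:E)%E.
  rewrite lee_fin normrM -[leRHS]mulr1 ler_wpM2l//.
  by have /andP[t0 t1] := bump_itv a b k x; rewrite ger0_norm.
have F0 k : (\int[leb]_(x in box a b) F k x = 0)%E.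
  have fin : (\int[leb]_(x in box a b) F k x)%E \is a fin_num.
    apply: integrable_fin_num => //; apply: le_integrable ig => //.
    exact: measurable_funTS.
  rewrite -(fineK fin).
  apply: (etrans _ (congr1 EFin (g0 _ (test_function_bump k abD)))); rewrite ipE.
  congr (fine _)%:E; rewrite [LHS]integral_mkcond; apply: eq_integral => x _.
  rewrite /F mul_patch /= /patch; case: ifPn => xab; case: ifPn => xD //=.
  - by have := abD x (sub_box (set_mem xab)); rewrite -in_setE (negbTE xD).
  - by rewrite bump_out ?mulr0// => /mem_set; rewrite (negbTE xab).
  - by rewrite mulr0.
have F0' : (fun k => \int[leb]_(x in box a b) F k x)%E = cst 0%E.
  by apply/funext => k; exact: F0.
suff H : (\int[leb]_(x in box a b) F k x)%E @[k --> \oo] -->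
    (\int[leb]_(x in box a b) ((g \_ D) x)%:E)%E.
  rewrite F0' in H.
  by apply: (cvg_unique (@ereal_hausdorff R) H); exact: cvg_cst.
apply: (@dominated_cvg _ _ _ leb (box a b) mQ F _ (fun x => `|(g \_ D) x|%:E)) => //.
- by move=> k; exact: measurable_funTS.
- move=> x abx; apply: cvg_EFin; first exact: nearW.
  rewrite -[X in _ --> X]mulr1; apply: cvgM; first exact: cvg_cst.
  exact: cvg_bump.
- exact: integrable_abse ig.
Qed.

Lemma open_cover_boxes D : open D -> exists (K : set nat) (lo hi : nat -> E),
  (forall k, K k -> closed_box (lo k) (hi k) `<=` D) /\
  D = \bigcup_(k in K) box (lo k) (hi k).
Proof.
move=> oD.
pose lo (q : 'rV[rat]_n * 'rV[rat]_n) : E := \row_i ratr (q.1 0 i).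
pose hi (q : 'rV[rat]_n * 'rV[rat]_n) : E := \row_i ratr (q.2 0 i).
(* The default is harmless: only codes whose closed box lies in [D] are retained. *)
pose code k := odflt (0, 0) (unpickle k) : 'rV[rat]_n * 'rV[rat]_n.
exists [set k | closed_box (lo (code k)) (hi (code k)) `<=` D],
  (lo \o code), (hi \o code); split=> //.
apply/seteqP; split=> [x Dx|x [k /= kD /sub_box]]; last exact: kD.
have [e e0 xeD] : exists2 e : R, 0 < e & ball x e `<=` D.
  by have /nbhs_ballP := open_nbhs_nbhs (conj oD Dx).
have Hlo i : exists r : rat, x 0 i - e / 2 < ratr r < x 0 i.
  by have [r] := @rat_in_itvoo R (x 0 i - e / 2) (x 0 i) ltac:(lra); rewrite in_itv /=; exists r.
have Hhi i : exists r : rat, x 0 i < ratr r < x 0 i + e / 2.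
  by have [r] := @rat_in_itvoo R (x 0 i) (x 0 i + e / 2) ltac:(lra); rewrite in_itv /=; exists r.
have [l Hl] := choice Hlo; have [h Hh] := choice Hhi.
pose q : 'rV[rat]_n * 'rV[rat]_n := (\row_i l i, \row_i h i).
have qE : code (pickle q) = q by rewrite /code pickleK.
have loE i : (lo q) 0 i = ratr (l i) by rewrite !mxE.
have hiE i : (hi q) 0 i = ratr (h i) by rewrite !mxE.
exists (pickle q); rewrite /= qE.
  move=> y yq; apply: xeD; split=> // i j; rewrite !ord1.
  have := yq j; rewrite loE hiE => /andP[ly yh].
  have /andP[l1 l2] := Hl j; have /andP[h1 h2] := Hh j.
  rewrite /ball /= ltr_norml; apply/andP; split; lra.
move=> i; rewrite loE hiE.
by have /andP[_ ->] := Hl i; have /andP[-> _] := Hh i.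
Qed.

Lemma test_function_ae_eq0 D g : open D -> L2 D g ->
  (forall t, test_function D t -> ip D g t = 0) ->
  \forall x \ae leb, D x -> g x = 0.
Proof.
move=> oD Lg g0; have [K [lo [hi [KD DE]]]] := open_cover_boxes oD.
have /ae_foralln : forall k, \forall x \ae leb,
    K k -> box (lo k) (hi k) x -> (EFin \o g \_ D) x = 0%E.
  move=> k; have [Kk|nKk] := pselect (K k); last by apply: nearW => x /nKk.
  suff : \forall x \ae leb, box (lo k) (hi k) x -> (EFin \o g \_ D) x = 0%E.
    by apply: filterS => x gx _ /gx.
  apply: integral_boxes_eq0; first exact: L2_integrable_box.
  move=> c; apply: (integral_box_eq0 Lg g0) => x xc; apply: (KD k Kk) => i.
  by have := xc i; rewrite mxE ge_max => /andP[/andP[-> _] ->].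
apply: filterS => x H Dx; move: (Dx); rewrite {1}DE => -[k Kk xk].
by have [] := H k Kk xk; rewrite /patch mem_set.
Qed.

Lemma open_measurable_rV D : open D -> measurable D.
Proof.
move=> /open_cover_boxes[K [lo [hi [_ ->]]]].
by apply: bigcup_measurable => k _; exact: measurable_box.
Qed.

Lemma continuous_measurable_rV v : continuous v -> measurable_fun setT v.
Proof.
move=> cv; apply: (measurability _ (RGenOInfty.measurableE R)) => _ [_ [c ->] <-].
rewrite setTI; apply: open_measurable_rV; move/continuousP : cv; apply.
exact: rray_open.
Qed.

End fundamental_lemma.

(** * Weak gradients *)

Section weak_gradients.
Context {R : realType} {n : nat}.
Local Notation E := 'rV[R]_n.
Local Notation leb := (lebesgue R n).
Implicit Types (D : set E) (g v w t : E -> R).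

Lemma L2_bounded D v a b (C : R) : measurable_fun setT (v \_ D) ->
  (forall x, D x -> `|v x| <= C) -> (forall x, D x -> ~ box a b x -> v x = 0) ->
  L2 D v.
Proof.
move=> mv vC v0; apply/andP; split; rewrite inE//=.
rewrite /finite_norm unlock poweR_lty//.
apply: (@le_lt_trans _ _ (\int[leb]_(x in box a b) (C ^+ 2)%:E)%E); last first.
  rewrite integral_cst; last exact: measurable_box.
  by rewrite lte_mul_pinfty ?lee_fin ?sqr_ge0//; exact: lebesgue_box.
rewrite [leRHS]integral_mkcond; apply: le_integral_nonmeasurable => x /=.
  by rewrite ?lee_fin ?powR_ge0 ?poweR_ge0.
rewrite powR_mulrn// /patch; case: ifPn => [/set_mem xD|_]; last first.
  by rewrite normr0 expr0n; case: ifP => _; rewrite lee_fin ?sqr_ge0.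
case: ifPn => xab; last first.
  by rewrite v0 ?normr0 ?expr0n// => /mem_set; rewrite (negbTE xab).
have vx := vC x xD.
by rewrite lee_fin ler_sqr// nnegrE// (le_trans _ vx).
Qed.

Lemma continuous_bounded_on (K : set E) v : compact K -> continuous v ->
  exists C, forall x, K x -> `|v x| <= C.
Proof.
move=> cK cv.
have := continuous_compact (continuous_subspaceT cv : {within K, continuous v}) cK.
move=> /compact_bounded[M [_ HM]]; exists (M + 1) => x Kx.
by apply: (HM (M + 1)); [rewrite ltrDl|exists x].
Qed.

(** The second function [s] allows one proof for a test function and for its partial derivatives. *)
Lemma smooth_supp_L2 D t s : measurable D -> test_function D t -> smooth s ->
  (forall x, ~ closure [set x | t x != 0] x -> s x = 0) -> L2 D s.
Proof.
move=> mD [_ cK KD] ss s0; have cs := smooth_continuous ss.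
have [C HC] := continuous_bounded_on cK cs.
have Hi i : exists ci, forall x, closure [set x | t x != 0] x -> `|x 0 i| <= ci.
  apply: (continuous_bounded_on (v := fun x : E => x 0 i)) cK _ => x.
  exact: coord_continuous.
have [c Hc] := choice Hi.
(* The margin 1 is there because [box] is open, and the absolute value because [C] may be negative
   when the support is empty. *)
apply: (@L2_bounded D s (\row_i (- c i - 1)) (\row_i (c i + 1)) `|C|).
- apply/(measurable_restrict _ mD measurableT).
  by apply: measurable_funTS; exact: continuous_measurable_rV.
- move=> x _; have [xK|xK] := pselect (closure [set x | t x != 0] x).
    by rewrite (le_trans (HC x xK))// ler_norm.
  by rewrite s0// normr0.
- move=> x _ xb; apply: s0 => xK; apply: xb => i; rewrite !mxE.
  have := Hc i x xK; rewrite ler_norml => /andP[? ?]; apply/andP; split; lra.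
Qed.

Lemma partial_out t x i : ~ closure [set x | t x != 0] x -> partial i t x = 0.
Proof.
move=> xK.
have t0 : \forall y \near x, (cst 0 : E -> R) y = t y.
  have : open_nbhs x (~` closure [set x | t x != 0]).
    by split=> //; apply: closed_openC; exact: closed_closure.
  move=> /open_nbhs_nbhs; apply: filterS => y yK.
  by apply/esym/eqP; apply: contra_notT yK => ty; exact: subset_closure.
by rewrite /partial -(near_eq_derive _ t0) derive_cst.
Qed.

Lemma test_function_L2 D t : measurable D -> test_function D t -> L2 D t.
Proof.
move=> mD tt; case: (tt) => st _ _; apply: smooth_supp_L2 tt _ _ => // x xK.
by apply/eqP; apply: contra_notT xK => tx; exact: subset_closure.
Qed.

Lemma partial_L2 D t i : measurable D -> test_function D t -> L2 D (partial i t).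
Proof.
move=> mD tt; case: (tt) => st _ _; apply: smooth_supp_L2 tt _ _ => //.
  exact: smooth_partial.
by move=> x; exact: partial_out.
Qed.

Lemma is_weak_gradient_lin D c v w (G H : E -> E) : open D -> L2 D v -> L2 D w ->
  is_weak_gradient D v G -> is_weak_gradient D w H ->
  is_weak_gradient D (fun x => c * v x + w x) (fun x => c *: G x + H x).
Proof.
move=> oD Lv Lw [LG vG] [LH wH]; have mD := open_measurable_rV oD.
have GE i : (fun x => (c *: G x + H x) 0 i) = (fun x => c * G x 0 i + H x 0 i).
  by apply/funext => x; rewrite !mxE.
split=> [i|i t tt]; first by rewrite GE; exact: L2_lin.
have Lt := test_function_L2 mD tt; have Lp := partial_L2 i mD tt.
by rewrite GE !ip_linl// vG// wH//; ring.
Qed.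

Lemma H1_lin D c v w : open D -> H1 D v -> H1 D w -> H1 D (fun x => c * v x + w x).
Proof.
move=> oD [Lv [G vG]] [Lw [H wH]]; split; first exact: L2_lin.
by exists (fun x => c *: G x + H x); exact: is_weak_gradient_lin.
Qed.

Lemma weak_gradient_unique D v (G H : E -> E) i : open D ->
  is_weak_gradient D v G -> is_weak_gradient D v H ->
  (fun x => G x 0 i) = (fun x => H x 0 i) %[ae leb in D].
Proof.
move=> oD [LG vG] [LH vH]; have mD := open_measurable_rV oD.
have : \forall x \ae leb, D x -> G x 0 i - H x 0 i = 0.
  apply: (@test_function_ae_eq0 R n D (fun x => G x 0 i - H x 0 i)) => //.
    exact: (L2B (LG i) (LH i)).
  move=> t tt; have Lt := test_function_L2 mD tt.
  rewrite (@ipBl _ _ _ (fun x => G x 0 i) (fun x => H x 0 i))//.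
  by apply/eqP; rewrite subr_eq0 -[X in X == _]opprK -vG// vH// opprK.
by apply: filterS => x GH Dx; apply/eqP; rewrite -subr_eq0 GH.
Qed.

Lemma dirichlet_linr D c u v w : open D -> H1 D u -> H1 D v -> H1 D w ->
  dirichlet D u (fun x => c * v x + w x) = c * dirichlet D u v + dirichlet D u w.
Proof.
move=> oD Hu Hv Hw; have Hvw := H1_lin c oD Hv Hw.
rewrite !dirichletE// mulr_sumr -big_split /=; apply: eq_bigr => i _.
have Lg z := @L2_weak_gradient _ _ D z i.
rewrite -ip_linr//; try exact: Lg.
apply: ip_ae; first exact/nearW.
pose S x := c *: weak_gradient D v x + weak_gradient D w x.
case: (Hv) (Hw) => Lv _ [Lw _].
have gS : is_weak_gradient D (fun x => c * v x + w x) S.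
  by apply: is_weak_gradient_lin => //; exact: weak_gradientP.
have := weak_gradient_unique i oD (weak_gradientP Hvw) gS.
by apply: filterS => x gx Dx; rewrite gx// !mxE.
Qed.

Lemma dirichlet_ae D u v w : v = w %[ae leb in D] -> dirichlet D u v = dirichlet D u w.
Proof. by move=> vw; rewrite /dirichlet (eq_weak_gradient vw). Qed.

Lemma dirichletBr D u v w : open D -> H1 D u -> H1 D v -> H1 D w ->
  dirichlet D u (v \- w) = dirichlet D u v - dirichlet D u w.
Proof.
move=> oD Hu Hv Hw; have := dirichlet_linr (-1) oD Hu Hw Hv.
under [X in dirichlet _ _ X = _ -> _]eq_fun do rewrite mulN1r addrC.
by rewrite mulN1r addrC.
Qed.

Lemma L2_subset D D' v : measurable D' -> D' `<=` D -> L2 D v -> L2 D' v.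
Proof.
move=> mD' D'D /andP[]; rewrite !inE /= => mv fv.
have vE : v \_ D' = (v \_ D) \_ D'.
  by rewrite -patch_setI setIidl.
apply/andP; split; rewrite inE /=.
  by rewrite vE; apply/(measurable_restrict _ mD' measurableT); exact: measurable_funTS.
apply: le_lt_trans fv; rewrite unlock.
apply: gt0_ler_poweR; rewrite ?in_itv /= ?andbT ?leey ?integral_ge0//;
  try by rewrite invr_ge0.
apply: le_integral_nonmeasurable => x; first by rewrite ?lee_fin ?poweR_ge0.
rewrite vE lee_fin ge0_ler_powR ?nnegrE//.
by rewrite {1}/patch; case: ifP => // _; rewrite normr0.
Qed.

Lemma test_function_subset D D' t : D' `<=` D -> test_function D' t -> test_function D t.
Proof. by move=> D'D [st ct tD']; split=> //; exact: subset_trans D'D. Qed.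

Lemma ip_subset D D' v w : D' `<=` D -> (forall x, ~ D' x -> w x = 0) ->
  ip D' v w = ip D v w.
Proof.
move=> D'D w0; rewrite !ipE; apply: eq_Rintegral => x _; rewrite /patch.
case: ifPn => [/set_mem/D'D/mem_set -> //|xD']; case: ifP => // _ /=.
by rewrite w0 ?mulr0// => /mem_set; rewrite (negbTE xD').
Qed.

(** The same weak gradient serves: a test function on [D'] is one on [D], and it vanishes with its
    derivatives off [D']. This places [u] in the broken space. *)
Lemma H1_subset D D' v : measurable D' -> D' `<=` D -> H1 D v -> H1 D' v.
Proof.
move=> mD' D'D [Lv [G [LG vG]]]; split; first exact: L2_subset Lv.
exists G; split=> [i|i t tt]; first exact: L2_subset (LG i).
have tD := test_function_subset D'D tt; case: (tt) => _ _ KD'.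
rewrite !(@ip_subset D D')//; first exact: vG.
  move=> x xD'; apply/eqP; apply: contra_notT xD' => tx.
  by apply: KD'; exact: subset_closure.
by move=> x xD'; apply: partial_out => /KD'.
Qed.

End weak_gradients.

(** * Simplices *)

Section simplices.
Context {R : realType}.

Definition affine_form n (nu : 'rV[R]_n) (x : 'rV[R]_n) : R := \sum_i nu 0 i * x 0 i.

Lemma measurable_affine_form n (nu : 'rV[R]_n) : measurable_fun setT (affine_form nu).
Proof.
apply: measurable_sum => i; apply: measurable_funM; first exact: measurable_cst.
exact: measurable_coord.
Qed.

Lemma measurable_hyperplane n (nu : 'rV[R]_n) c : measurable [set x | affine_form nu x = c].
Proof.
have := measurable_affine_form nu measurableT (measurable_set1 c).
by rewrite setTI.
Qed.

Lemma affine_form_cons n (nu : 'rV[R]_n.+1) p :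
  affine_form nu (cons_rV p) = nu 0 (lshift n 0 : 'I_(1 + n)) * p.1 +
    affine_form (\row_j nu 0 (rshift 1 j : 'I_(1 + n))) p.2.
Proof.
rewrite /affine_form (@big_split_ord _ _ _ 1 n) /= big_ord1 cons_rV_lshift.
by congr (_ + _); apply: eq_bigr => j _; rewrite cons_rV_rshift mxE.
Qed.

(** Induction along the product that defines [lebesgue]: if the tail of [nu] is nonzero, every slice
    is a null hyperplane; otherwise the set is a point times the whole space. *)
Lemma lebesgue_hyperplane n (nu : 'rV[R]_n) c : nu != 0 ->
  lebesgue R n [set x | affine_form nu x = c] = 0%E.
Proof.
elim: n nu c => [|n IH] nu c nu0.
  by move: nu0; rewrite (_ : nu = 0) ?eqxx//; apply/rowP => -[].
rewrite /= /lebesgue_step /pushforward.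
set nu1 : R := nu 0 (lshift n 0 : 'I_(1 + n)).
set nu2 : 'rV[R]_n := \row_j nu 0 (rshift 1 j : 'I_(1 + n)).
have -> : cons_rV @^-1` [set x | affine_form nu x = c] =
    [set p : measurableTypeR R * 'rV[R]_n | nu1 * p.1 + affine_form nu2 p.2 = c].
  by apply/seteqP; split=> p /=; rewrite affine_form_cons.
have [nu20|nu2n0] := eqVneq nu2 0; last first.
  apply: integral0_eq => s _ /=.
  rewrite -(IH nu2 (c - nu1 * s) nu2n0); congr (lebesgue R n _).
  apply/seteqP; split=> y; rewrite /xsection /= inE /=.
    by move=> <-; rewrite addrAC subrr add0r.
  by move=> ->; rewrite addrC subrK.
have nu1n0 : nu1 != 0.
  apply: contraNneq nu0 => nu10; apply/eqP/rowP => i; rewrite mxE.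
  case: (@split_ordP 1 n i) => j ->; first by rewrite ord1.
  by move/rowP : nu20 => /(_ j); rewrite !mxE.
rewrite (_ : [set p | _] = [set c / nu1] `*` setT).
  rewrite product_measure1E//.
  by have := lebesgue_measure_set1 (c / nu1) => /= ->; rewrite mul0e.
have f0 y : affine_form nu2 y = 0.
  by rewrite nu20 /affine_form big1// => i _; rewrite mxE mul0r.
apply/seteqP; split=> -[s y] /=; rewrite f0 addr0.
  by move=> <-; split=> //; rewrite mulrC mulKf.
by move=> [-> _]; rewrite mulrC divfK.
Qed.

(** The differences to one chosen point number fewer than [n], so some nonzero vector is orthogonal
    to all of them. *)
Lemma exists_hyperplane n (I : finType) (v : I -> 'rV[R]_n) (F : {set I}) :
  (0 < #|F| <= n)%N ->
  exists (nu : 'rV[R]_n) c, nu != 0 /\ forall j, j \in F -> affine_form nu (v j) = c.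
Proof.
move=> /andP[/card_gt0P[j0 j0F] Fn].
pose s := enum (F :\ j0)%SET; pose C := \matrix_(k < size s) (v (nth j0 s k) - v j0).
have sn : (size s < n)%N.
  by apply: leq_trans Fn; rewrite -cardE [leqRHS](cardsD1 j0) j0F.
have : kermx C^T != 0.
  rewrite -mxrank_eq0 mxrank_ker subn_eq0 -ltnNge.
  by apply: leq_ltn_trans sn; exact: rank_leq_col.
move=> /rowV0Pn[nu /sub_kermxP nuC nu0].
exists nu, (affine_form nu (v j0)); split=> // j jF.
have [->//|jj0] := eqVneq j j0.
have js : j \in s by rewrite mem_enum !inE jj0.
have jlt : (index j s < size s)%N by rewrite index_mem.
move/rowP : nuC => /(_ (Ordinal jlt)).
rewrite !mxE => H; apply/eqP; rewrite -subr_eq0 -H -sumrB; apply/eqP.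
by apply: eq_bigr => i _; rewrite !mxE /= nth_index// mulrBr.
Qed.

End simplices.

(** * Cells of the mesh and piecewise constant functions *)

Section mesh_cells.
Context {R : realType} {n : nat}.
Variables (Om : set 'rV[R]_n) (M : mesh R n).
Local Notation leb := (lebesgue R n).
Local Notation index_set := {set 'I_(nb_vertices M)}.
Implicit Types (T : index_set).

Lemma affine_form_sum (nu : 'rV[R]_n) (S : index_set) (l : 'I_(nb_vertices M) -> R) :
  affine_form nu (\sum_(i in S) l i *: vertex i) =
  \sum_(i in S) l i * affine_form nu (vertex i).
Proof.
under [RHS]eq_bigr do rewrite mulr_sumr.
rewrite exchange_big; apply: eq_bigr => j _ /=.
rewrite summxE mulr_sumr; apply: eq_bigr => i _.
by rewrite !mxE mulrCA.
Qed.

(** A point of the closed simplex outside the open one has a vanishing coefficient, hence lies in a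
    hyperplane through the other [n] vertices. *)
Lemma ae_open_simplex T : (0 < n)%N -> #|T| = n.+1 ->
  \forall x \ae leb, closed_simplex T x -> open_simplex T x.
Proof.
move=> n0 cT.
have H (i : 'I_(nb_vertices M)) : exists A : set 'rV[R]_n,
    [/\ measurable A, leb A = 0%E & i \in T -> forall l : 'I_(nb_vertices M) -> R,
      l i = 0 -> \sum_(j in T) l j = 1 -> A (\sum_(j in T) l j *: vertex j)].
  have [iT|] := boolP (i \in T); last by exists set0; split=> //; rewrite measure0.
  have cF : #|(T :\ i)%SET| = n by move: cT; rewrite (cardsD1 i) iT => -[].
  have [|nu [c [nu0 nuc]]] := @exists_hyperplane R n _ (@vertex R n M) (T :\ i)%SET.
    by rewrite cF leqnn n0.
  exists [set x | affine_form nu x = c]; split.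
  - exact: measurable_hyperplane.
  - exact: lebesgue_hyperplane.
  - move=> _ l li0 l1 /=; rewrite affine_form_sum.
    rewrite (bigD1 i)//= li0 mul0r add0r.
    under eq_bigr => j jT.
      rewrite nuc; last by rewrite !inE andbC.
      over.
    rewrite -mulr_suml; move: l1; rewrite (bigD1 i)//= li0 add0r => ->.
    exact: mul1r.
have [A HA] := choice H.
have : \forall x \ae leb, forall i, ~ A i x.
  apply: filter_forall => i; exists (A i); have [mA A0 _] := HA i; split=> //.
  by move=> x /= /contrapT.
apply: filterS => x Ax [l [l0 l1 xE]]; exists l; split=> // i iT.
rewrite lt_neqAle l0// andbT; apply/negP => /eqP li0.
have [_ _ /(_ iT l (esym li0) l1)] := HA i; rewrite -xE; exact: Ax.
Qed.

Lemma ae_cells : (0 < n)%N -> conforming_partition Om M ->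
  \forall x \ae leb, Om x -> exists2 T, T \in cells M & open_simplex T x.
Proof.
move=> n0 [cM _ OmE _].
have : \forall x \ae leb, forall T, T \in cells M -> closed_simplex T x -> open_simplex T x.
  apply: filter_forall => T; have [TM|] := boolP (T \in cells M); last first.
    by move=> _; exact: nearW.
  have [cT _] := cM T TM.
  by apply: filterS (ae_open_simplex n0 cT) => x ? _.
apply: filterS => x Hx /subset_closure; rewrite OmE => -[T TM xT].
by exists T => //; exact: Hx.
Qed.

(** The coefficients are affine functions of the point because the homogenized vertices (1, v_i),
    for i in [T], are linearly independent. This describes the open simplex by measurable
    conditions. *)
Lemma barycentric_coordinates T : affinely_independent T ->
  exists (b : 'I_(nb_vertices M) -> R) (nu : 'I_(nb_vertices M) -> 'rV[R]_n),
    forall (l : 'I_(nb_vertices M) -> R) i, i \in T -> \sum_(j in T) l j = 1 ->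
      l i = b i + affine_form (nu i) (\sum_(j in T) l j *: vertex j).
Proof.
move=> aT; set N := nb_vertices M.
pose row_ (i : 'I_N) : 'rV[R]_(1 + n) := row_mx (1%:M : 'M[R]_1) (vertex i).
pose A : 'M[R]_(N, 1 + n) := \matrix_(i < N) (if i \in T then row_ i else 0).
pose D : 'M[R]_N := diag_mx (\row_i (i \in T)%:R).
have lA (l : 'rV[R]_N) : l *m A =
    row_mx ((\sum_(j in T) l 0 j)%:M : 'M[R]_1) (\sum_(j in T) l 0 j *: vertex j).
  rewrite mulmx_sum_row.
  rewrite (eq_bigr (fun j => if j \in T then l 0 j *: row_ j else 0)); last first.
    by move=> j _; rewrite rowK; case: ifP => // _; rewrite scaler0.
  rewrite -big_mkcond /=.
  under eq_bigr do rewrite scale_row_mx -scalemx1 scalerA mulr1 scalemx1.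
  elim/big_rec3 : _ => [|j x y z _ ->].
    by rewrite -row_mx0; congr row_mx; apply/matrixP => a b; rewrite !mxE mul0rn.
  by rewrite add_row_mx raddfD.
have lD (l : 'rV[R]_N) i : i \in T -> (l *m D) 0 i = l 0 i.
  by move=> iT; rewrite mul_mx_diag !mxE iT mulr1.
have [B DAB] : exists B, D = A *m B.
  have : (D^T <= A^T)%MS.
    (* Rows of [K^T] are linear relations between the rows of [A]; affine independence annihilates
       their entries in [T], the only ones that [D] sees. *)
    rewrite submxE; set K := cokermx A^T.
    have KA : K^T *m A = 0 by apply: trmx_inj; rewrite trmx_mul trmxK mulmx_coker trmx0.
    rewrite -trmx_eq0 trmx_mul trmxK; apply/eqP/matrixP => i j.
    rewrite mul_mx_diag !mxE; have [jT|] := boolP (j \in T); last by rewrite mulr0.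
    rewrite mulr1; have := lA (row i K^T); rewrite -row_mul KA row0 => /esym/eqP.
    rewrite row_mx_eq0 => /andP[/eqP l0 /eqP lv].
    have := aT (fun j => row i K^T 0 j) _ lv j jT; rewrite !mxE; apply.
    by move/matrixP : l0 => /(_ 0 0); rewrite !mxE eqxx mulr1n.
  move=> /submxP[B DB]; exists B^T.
  by apply: trmx_inj; rewrite trmx_mul trmxK.
exists (fun i => B (lshift n 0) i), (fun i => \row_j B (rshift 1 j) i) => l i iT l1.
pose L : 'rV[R]_N := \row_j l j.
have -> : l i = (L *m D) 0 i by rewrite lD// mxE.
rewrite DAB mulmxA lA mxE big_split_ord /= big_ord1 row_mxEl mxE eqxx mulr1n.
have -> : \sum_(j in T) L 0 j = 1 by rewrite -[RHS]l1; apply: eq_bigr => j _; rewrite mxE.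
rewrite mul1r; congr (_ + _); apply: eq_bigr => j _.
rewrite row_mxEr !mxE mulrC; congr (_ * _).
by congr (fun_of_matrix _ _ _); apply: eq_bigr => k _; rewrite mxE.
Qed.

Lemma measurable_open_simplex T : affinely_independent T -> measurable (open_simplex T).
Proof.
move=> /barycentric_coordinates[b [nu H]].
pose lam i x := b i + affine_form (nu i) x.
have mlam i : measurable_fun setT (lam i).
  by apply: measurable_funD; [exact: measurable_cst|exact: measurable_affine_form].
have mset (g h : 'rV[R]_n -> R) : measurable_fun setT g -> measurable_fun setT h ->
    measurable [set x | g x = h x].
  move=> mg mh; have := measurable_funB mg mh measurableT (measurable_set1 0).
  rewrite setTI; congr measurable; apply/seteqP; split=> x /=.
    by move/eqP; rewrite subr_eq0 => /eqP.
  by move=> ->; rewrite subrr.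
rewrite (_ : open_simplex T =
  \bigcap_(i in [set i | i \in T]) [set x | lam i x \in `]0, +oo[] `&`
  [set x | \sum_(i in T) lam i x = 1] `&`
  \bigcap_(j in [set: 'I_n]) [set x : 'rV[R]_n | x 0 j = \sum_(i in T) lam i x * vertex i 0 j]).
  apply: measurableI; first apply: measurableI.
  - apply: fin_bigcap_measurable => // i _.
    have := mlam i measurableT _ (measurable_itv (`]0, +oo[ : interval R)).
    by rewrite setTI.
  - apply: (mset _ (cst 1)); last exact: measurable_cst.
    under eq_fun do rewrite big_mkcond /=.
    by apply: measurable_sum => i; case: (i \in T); [exact: mlam|exact: measurable_cst].
  - apply: fin_bigcap_measurable => // j _; apply: mset; first exact: measurable_coord.
    under eq_fun do rewrite big_mkcond /=.
    apply: measurable_sum => i; case: (i \in T); last exact: measurable_cst.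
    by apply: measurable_funM; [exact: mlam|exact: measurable_cst].
apply/seteqP; split=> [x [l [l0 l1 xE]]|x [[x0 x1] xE]].
  have lE i : i \in T -> l i = lam i x by move=> iT; rewrite (H l i iT l1) -xE.
  split; first split.
  - by move=> i /= iT; rewrite in_itv /= -lE// l0.
  - by rewrite /= -l1; apply: eq_bigr => i iT; rewrite lE.
  - move=> j _ /=; rewrite {1}xE summxE; apply: eq_bigr => i iT.
    by rewrite mxE lE.
exists (lam ^~ x); split=> //.
  by move=> i iT; have := x0 i iT; rewrite /= in_itv /= andbT.
apply/rowP => j; rewrite (xE j I) summxE; apply: eq_bigr => i _.
by rewrite mxE.
Qed.

Lemma broken_H1_H1 v : conforming_partition Om M -> H1 Om v -> broken_H1 Om M v.
Proof.
move=> [cM Tsub _ _] H1v; split; first by case: H1v.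
move=> T TM; apply: H1_subset H1v; last exact: Tsub.
by have [_ /measurable_open_simplex] := cM T TM.
Qed.

Lemma broken_poly0P v : broken_poly Om M 0 v <->
  L2 Om v /\ forall T, T \in cells M -> exists c : R, v = cst c %[ae leb in open_simplex T].
Proof.
split=> -[Lv vc]; split=> // T TM; have {vc}[c vc] := vc T TM.
  exists (\sum_(m : {ffun 'I_n -> 'I_1} | (\sum_i m i <= 0)%N) c m).
  apply: filterS vc => x vx xT; rewrite vx//; apply: eq_bigr => k _.
  by rewrite big1 ?mulr1// => i _; rewrite ord1 expr0.
exists (fun m => if m == [ffun=> 0] then c else 0).
apply: filterS vc => x vx xT; rewrite vx//.
rewrite (bigD1 [ffun=> 0])/=; last by rewrite big1// => i _; rewrite ffunE.
rewrite eqxx big1 ?mulr1; last by move=> i _; rewrite ffunE expr0.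
by rewrite big1 ?addr0// => k /andP[_ /negbTE ->]; rewrite mul0r.
Qed.

Lemma broken_poly0B v w : broken_poly Om M 0 v -> broken_poly Om M 0 w ->
  broken_poly Om M 0 (v \- w).
Proof.
move=> /broken_poly0P[Lv vc] /broken_poly0P[Lw wc]; apply/broken_poly0P.
split=> [|T TM]; first exact: L2B.
have [c vcE] := vc T TM; have [d wdE] := wc T TM; exists (c - d).
by apply: filterS2 vcE wdE => x vx wx xT; rewrite /= vx// wx.
Qed.

(** Finitely many constants bound [v], since almost every point of [Om] lies in an open cell. This
    makes [grad_Rstar_superposition] applicable to the iterates. *)
Lemma broken_poly0_Linfty v : (0 < n)%N -> conforming_partition Om M ->
  broken_poly Om M 0 v -> Linfty Om v.
Proof.
move=> n0 cM /broken_poly0P[Lv vc].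
have H T : exists c : R, T \in cells M -> v = cst c %[ae leb in open_simplex T].
  have [TM|TM] := boolP (T \in cells M); last by exists 0.
  by have [c] := vc T TM; exists c.
have [c Hc] := choice H.
have vb : \forall x \ae leb, `|(v \_ Om) x| <= \sum_T `|c T|.
  have : \forall x \ae leb, forall T, T \in cells M -> open_simplex T x -> v x = c T.
    apply: filter_forall => T; have [TM|] := boolP (T \in cells M); last first.
      by move=> _; exact: nearW.
    by apply: filterS (Hc T TM) => x + _.
  apply: filterS2 (ae_cells n0 cM) => x xT vx; rewrite /patch.
  case: ifPn => [/set_mem/xT[T TM Tx]|_]; last by rewrite normr0 sumr_ge0.
  by rewrite (vx T)// (bigD1 T)//= lerDl sumr_ge0.
apply/andP; split; rewrite inE /=; first exact: measurable_L2.
rewrite /finite_norm unlock /=; case: ifP => // _.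
apply: (@le_lt_trans _ _ (\sum_T `|c T|)%:E); last exact: ltry.
by apply/ess_supP.
Qed.

End mesh_cells.

(** * Linear functionals on a finite-dimensional space *)

Section linear_functionals.
Context {R : realType} {V : normedModType R}.
Implicit Types (l : V -> R) (ah : V -> V -> R) (v w : V).

Lemma scalar_sum l (I : Type) (r : seq I) (c : I -> R) (b : I -> V) :
  scalar l -> l (\sum_(i <- r) c i *: b i) = \sum_(i <- r) c i * l (b i).
Proof.
move=> ll; elim: r => [|i r IH]; last by rewrite !big_cons ll IH.
by rewrite !big_nil; have := ll (-1) 0 0; rewrite scaler0 addr0 mulN1r addNr.
Qed.

Lemma scalar0 l : scalar l -> l 0 = 0.
Proof. by move=> ll; have := ll (-1) 0 0; rewrite scaler0 addr0 mulN1r addNr. Qed.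

Lemma scalarZ l c v : scalar l -> l (c *: v) = c * l v.
Proof. by move=> ll; rewrite -[c *: v]addr0 ll scalar0// addr0. Qed.

Lemma scalarB l v w : scalar l -> l (v - w) = l v - l w.
Proof. by move=> ll; rewrite addrC -scaleN1r ll mulN1r addrC. Qed.

(* The vector (l b_i) is orthogonal to the kernel of the Gram matrix of ah, as a
   combination of the b_i of zero energy vanishes; so it is in its range. *)
Lemma coercive_riesz ah (Cc Cb : R) l : finite_dimensional V -> symmetric_bilinear ah ->
  0 < Cc -> coercive_bounded ah Cc Cb -> scalar l -> exists r, forall v, l v = ah r v.
Proof.
move=> [N [b bV]] [ahC ahl] Cc0 [coer _] ll.
pose G : 'M[R]_N := \matrix_(i, j) ah (b i) (b j).
pose L : 'rV[R]_N := \row_j l (b j).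
have ahr c v : ah v (\sum_i c i *: b i) = \sum_i c i * ah v (b i) by exact: scalar_sum.
have : (L <= G)%MS.
  rewrite submxE; set K := cokermx G.
  have GK : G *m K = 0 by exact: mulmx_coker.
  apply/eqP/rowP => k; rewrite !mxE.
  under eq_bigr do rewrite [L _ _]mxE mulrC.
  pose z := \sum_i K i k *: b i.
  have bz i : ah (b i) z = 0.
    rewrite ahr; have /matrixP/(_ i k) := GK; rewrite !mxE => GKik.
    apply: etrans GKik.
    by apply: eq_bigr => j _; rewrite [G _ _]mxE mulrC.
  have zz : ah z z = 0.
    by rewrite {2}/z ahr big1// => i _; rewrite ahC bz mulr0.
  have z0 : z = 0.
    have := coer z; rewrite zz pmulr_rle0// => z2.
    apply/eqP; rewrite -normr_eq0 -sqrf_eq0 eq_le z2 sqr_ge0//.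
  have <- : l z = \sum_i K i k * l (b i) by exact: scalar_sum.
  by rewrite z0 scalar0.
move=> /submxP[c Lc]; exists (\sum_i c 0 i *: b i) => v.
have [d ->] := bV v; rewrite scalar_sum// ahr; apply: eq_bigr => j _; congr (_ * _).
have /rowP/(_ j) := Lc; rewrite !mxE => ->; rewrite ahC ahr.
by apply: eq_bigr => i _; rewrite [G _ _]mxE ahC.
Qed.

Lemma coercive_bounded_norm ah (Cc Cb : R) v w : symmetric_bilinear ah ->
  coercive_bounded ah Cc Cb -> `|ah v w| <= Cb * `|v| * `|w|.
Proof.
move=> [_ ahl] [_ bd]; rewrite ler_norml bd andbT lerNl.
have := bd v (- w); rewrite normrN; apply: le_trans.
by rewrite -(scaleN1r w) (scalarZ _ _ (ahl v)) mulN1r.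
Qed.

(** The value of [C] is immaterial: it only ensures that the [sup] is taken over a bounded set. *)
Lemma dual_norm_le l (C : R) v : scalar l -> (forall w, `|l w| <= C * `|w|) ->
  `|l v| <= dual_norm l * `|v|.
Proof.
move=> ll lC; have [->|v0] := eqVneq v 0; first by rewrite scalar0// !normr0 mulr0.
have nv : 0 < `|v| by rewrite normr_gt0.
rewrite -ler_pdivrMr//.
apply: sup_ubound.
  exists `|C| => _ [w /= w1 <-]; apply: le_trans (lC w) _.
  rewrite (le_trans (ler_wpM2r _ (ler_norm C)))//.
  by rewrite -[leRHS]mulr1 ler_wpM2l.
exists (`|v|^-1 *: v) => /=; first by rewrite normrZ normfV normr_id mulVf ?gt_eqF.
by rewrite scalarZ// normrM normfV normr_id mulrC.
Qed.

Lemma dual_norm_young l (C c : R) v : 0 < c -> scalar l ->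
  (forall w, `|l w| <= C * `|w|) ->
  `|l v| <= c / 4 * `|v| ^+ 2 + c^-1 * dual_norm l ^+ 2.
Proof.
move=> c0 ll lC; apply: le_trans (dual_norm_le v ll lC) _.
move: (dual_norm l) `|v| => d y; rewrite -subr_ge0.
have -> : c / 4 * y ^+ 2 + c^-1 * d ^+ 2 - d * y = c * (y / 2 - d / c) ^+ 2.
  by field; rewrite gt_eqF.
by rewrite mulr_ge0 ?sqr_ge0// ltW.
Qed.

End linear_functionals.

(** * Bregman divergences *)

Section bregman_divergence.
Context {R : realType}.

Lemma legendre_fin_num c (g : R -> \bar R) y : legendre c g -> c <= y -> g y \is a fin_num.
Proof.
move=> [gNy gy _ _ _] /gy gyo; rewrite fin_numE; apply/andP; split.
  by apply/eqP => gyN; have := gNy y; rewrite gyN.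
by rewrite lt_eqF.
Qed.

(** As [u] may be the endpoint [c], only the derivative at [o] is used: by convexity, the difference
    quotients from [o] towards [u] are at most g(u) - g(o). *)
Lemma legendre_tangent c (g : R -> \bar R) o u : legendre c g -> c < o -> c <= u ->
  fine (g o) + derive1 (fine \o g) o * (u - o) <= fine (g u).
Proof.
move=> [_ _ cvx der _] co cu; set r := fine \o g.
have [->|uo] := eqVneq u o; first by rewrite subrr mulr0 addr0.
have dr : is_derive o (1 : R) r (derive1 r o).
  by apply: DeriveDef; [exact: der|rewrite derive1E].
pose F (h : R) := r (h * (u - o) + o).
have [dF dFE] : is_derive (0 : R) (1 : R) F (derive1 r o * (u - o)).
  apply: (@is_derive1_comp _ r (fun h : R => h * (u - o) + o)).
    by rewrite mul0r add0r.
  have -> : (fun h : R => h * (u - o) + o) = (u - o) *: (id : R -> R) + cst o.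
    by apply/funext => h; rewrite /= fctE /= /GRing.scale /= mulrC.
  by apply: is_derive_eq; rewrite addr0 scaler1.
rewrite -lerBrDl -dFE.
have cvF : h^-1 *: ((F \o shift 0) (h *: (1 : R)) - F 0) @[h --> 0^'+] --> 'D_1 F 0.
  exact: cvg_dnbhs_at_right dF.
rewrite -(cvg_lim _ cvF)//; apply: limr_le; first by apply/cvg_ex; exists ('D_1 F 0).
near=> h; have h0 : 0 < h by [].
have h1 : h < 1 by [].
rewrite /= /GRing.scale /= mulr1 addr0 ler_pdivrMl// /F mul0r add0r lerBlDr.
have := cvx u o h cu (ltW co) uo; rewrite h0 h1 => /(_ isT).
rewrite (_ : h * u + (1 - h) * o = h * (u - o) + o); last by ring.
by rewrite -/r /r /= => /ltW; lra.
Unshelve. all: by end_near.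
Qed.

Variables (n : nat) (Om : set 'rV[R]_n) (phi : 'rV[R]_n -> R)
  (Rf : 'rV[R]_n -> R -> \bar R).
Hypothesis hRf : legendre_setting Om phi Rf.
Local Notation E := 'rV[R]_n.
Local Notation leb := (lebesgue R n).
Implicit Types (u w psi chi : E -> R).

(** The exceptional null set is independent of [w], which will be both [u] and another iterate. Off
    it every value of [Rf] involved is finite, so the divergence is a real number. *)
Lemma ae_bregmanE psi : \forall x \ae leb, Om x -> forall w, phi x <= w x ->
  [/\ bregman Rf w (grad_Rstar Rf psi) x =
       (fine (Rf x (w x)) - fine (Rf x (grad_Rstar Rf psi x))
          - psi x * (w x - grad_Rstar Rf psi x))%:E,
      (0 <= bregman Rf w (grad_Rstar Rf psi) x)%E
    & phi x < grad_Rstar Rf psi x].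
Proof.
have [[_ leg] _ inv _] := hRf.
apply: filterS2 leg inv => x leg inv Omx w phw.
have [_ legx _] := leg Omx; have [/(_ (psi x))[pho grad_o] _] := inv Omx.
have gE : grad_R Rf (grad_Rstar Rf psi) x = psi x by rewrite /grad_R.
have bE : bregman Rf w (grad_Rstar Rf psi) x =
   (fine (Rf x (w x)) - fine (Rf x (grad_Rstar Rf psi x))
      - psi x * (w x - grad_Rstar Rf psi x))%:E.
  rewrite /bregman gE -(fineK (legendre_fin_num legx phw)).
  by rewrite -(fineK (legendre_fin_num legx (ltW pho))).
split=> //; rewrite bE lee_fin subr_ge0 lerBrDl.
by have := legendre_tangent legx pho phw; rewrite grad_o.
Qed.

Lemma bregman_integral_ge0 u psi : (\forall x \ae leb, Om x -> phi x <= u x) ->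
  (0 <= bregman_integral Om Rf u (grad_Rstar Rf psi))%E.
Proof.
move=> phu; rewrite /bregman_integral.
rewrite (@ae_eq_lower_integral _ _ _ leb Om _
  (fun x => maxe 0 (bregman Rf u (grad_Rstar Rf psi) x))%E).
  by apply: integral_ge0 => x _; rewrite le_max lexx.
apply: filterS2 phu (ae_bregmanE psi) => x phu bE Omx.
by have [_ b0 _] := bE Omx u (phu Omx); rewrite max_r.
Qed.

(* The three point identity, in which D(o, o') >= 0 is dropped. *)
Lemma bregman_integral_step u psi chi : (\forall x \ae leb, Om x -> phi x <= u x) ->
  L2 Om (psi \- chi) -> L2 Om (u \- grad_Rstar Rf psi) ->
  (bregman_integral Om Rf u (grad_Rstar Rf psi)
     + (ip Om (psi \- chi) (u \- grad_Rstar Rf psi))%:E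
   <= bregman_integral Om Rf u (grad_Rstar Rf chi))%E.
Proof.
move=> phu Ld Lu; set o := grad_Rstar Rf psi; set o' := grad_Rstar Rf chi.
(* Divergences are nonnegative only almost everywhere; the maximum makes the integrand nonnegative
   at every point. *)
pose f v x := maxe 0%E ((bregman Rf u v \_ Om) x).
have f0 v x : (0 <= f v x)%E by rewrite le_max lexx.
have fE v theta : v = grad_Rstar Rf theta ->
    bregman_integral Om Rf u v = (\int[leb]_x f v x)%E.
  move=> ->; rewrite /bregman_integral integral_mkcond; apply: ae_eq_lower_integral.
  apply: filterS2 phu (ae_bregmanE theta) => x phu bE _; rewrite /f /patch.
  case: ifPn => [/set_mem Omx|_]; last by rewrite maxxx.
  by have [_ b0 _] := bE Omx u (phu Omx); rewrite max_r.
rewrite (fE o psi)// (fE o' chi)//.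
have ii := ip_integrable Ld Lu.
rewrite ipE /Rintegral fineK; last exact: integrable_fin_num.
apply: ge0_lower_integralD => //.
apply: filterS3 phu (ae_bregmanE psi) (ae_bregmanE chi) => x phu bE bE'.
rewrite /f /patch; case: ifPn => [/set_mem Omx|_]; last by rewrite adde0.
have [uoE uo0 pho] := bE Omx u (phu Omx).
have [uo'E uo'0 _] := bE' Omx u (phu Omx).
have [oo'E oo'0 _] := bE' Omx o (ltW pho).
rewrite !max_r// -/o -/o' uoE uo'E -EFinD lee_fin.
by move: oo'0; rewrite oo'E lee_fin /=; rewrite -/o -/o'; lra.
Qed.

End bregman_divergence.

(** * The discrete scheme *)

Section discrete_scheme.
Context {R : realType} {n : nat} {Vh : normedModType R}.
Local Notation E := 'rV[R]_n.
Local Notation leb := (lebesgue R n).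
Variables (Om : set E) (M : mesh R n).
Implicit Types (f phi u z : E -> R) (p : Vh -> E -> R) (v w : Vh).

Lemma reconstruction_L2 VT p v : between_P0_P1 Om M VT -> reconstruction Om M VT p ->
  L2 Om (p v).
Proof. by move=> [_ VT1 _] [pVT _ _]; have [] := VT1 _ (pVT v). Qed.

Lemma scalar_ip_reconstruction VT p z : between_P0_P1 Om M VT ->
  reconstruction Om M VT p -> L2 Om z -> scalar (fun v => ip Om z (p v)).
Proof.
move=> hVT hp Lz c v w; have [_ plin _] := hp.
have Lp y := reconstruction_L2 y hVT hp.
apply: etrans (ip_linr c (Lp v) (Lp w) Lz).
by apply: ip_ae; [exact/nearW|exact: plin].
Qed.

Lemma scalar_dirichlet_operator VT p Ch u : open Om -> between_P0_P1 Om M VT ->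
  reconstruction Om M VT p -> conforming_operator Om M Ch -> H1 Om u ->
  scalar (fun v => dirichlet Om u (Ch (p v))).
Proof.
move=> oOm hVT hp [ChH Chae Chlin _] Hu c v w; have [_ plin _] := hp.
have Lp y := reconstruction_L2 y hVT hp.
have H1Ch y : H1 Om (Ch (p y)) by have [_ []] := ChH _ (Lp y).
apply: etrans (dirichlet_linr c oOm Hu (H1Ch v) (H1Ch w)).
apply: etrans (dirichlet_ae u (Chlin c _ _ (Lp v) (Lp w))).
by apply: dirichlet_ae; apply: Chae => //; exact: L2_lin.
Qed.

Section energy.
Variables (ah : Vh -> Vh -> R) (L : Vh -> R).
Hypotheses (ahP : symmetric_bilinear ah) (LP : scalar L).
Hypothesis ah0 : forall v, 0 <= ah v v.

Definition energy v : R := ah v v / 2 - L v.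

Lemma ahBl v w y : ah (v - w) y = ah v y - ah w y.
Proof. by case: ahP => ahC ahl; rewrite ahC scalarB// !(ahC y). Qed.

Lemma ahBr v w y : ah y (v - w) = ah y v - ah y w.
Proof. by case: ahP => ahC ahl; rewrite scalarB. Qed.

(** A quadratic energy expanded at either end. At [v], with the square dropped, it yields the
    residual of the equation solved by [v]; at [w], the square is kept for coercivity. *)
Lemma energyB_left v w :
  energy v - energy w = ah v (v - w) - L (v - w) - ah (v - w) (v - w) / 2.
Proof.
rewrite /energy !ahBl !ahBr (scalarB _ _ LP).
by have [ahC _] := ahP; rewrite (ahC w v); field.
Qed.

Lemma energyB_right v w :
  energy v - energy w = ah w (v - w) - L (v - w) + ah (v - w) (v - w) / 2.
Proof.
rewrite /energy !ahBl !ahBr (scalarB _ _ LP).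
by have [ahC _] := ahP; rewrite (ahC w v); field.
Qed.

Lemma energyB_le v w : energy v - energy w <= ah v (v - w) - L (v - w).
Proof. by rewrite energyB_left gerBl divr_ge0. Qed.

End energy.

Lemma consistency_error_le VT p ah (Cc Cb : R) Pi Ch u : open Om ->
  finite_dimensional Vh -> between_P0_P1 Om M VT ->
  reconstruction Om M VT p -> conforming_operator Om M Ch -> H1 Om u ->
  symmetric_bilinear ah -> 0 < Cc -> coercive_bounded ah Cc Cb ->
  scalar (consistency_error Om p ah Pi Ch u) /\
  forall v, `|consistency_error Om p ah Pi Ch u v| <=
    Cc / 4 * `|v| ^+ 2 + Cc^-1 * dual_norm (consistency_error Om p ah Pi Ch u) ^+ 2.
Proof.
move=> oOm fd hVT hp hCh Hu ahP Cc0 cb.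
have ld := scalar_dirichlet_operator oOm hVT hp hCh Hu.
have sl : scalar (consistency_error Om p ah Pi Ch u).
  have [_ ahl] := ahP => c v w; rewrite /consistency_error.
  have -> : ah (Pi u) (c *: v + w) = c * ah (Pi u) v + ah (Pi u) w := ahl _ _ _ _.
  have -> := ld c v w.
  by move: (dirichlet _ _ _) (dirichlet _ _ _) => y z; rewrite opprD mulrBr addrACA.
split=> // v; have [r rE] := coercive_riesz fd ahP Cc0 cb sl.
apply: (@dual_norm_young _ _ _ (Cb * `|r|)) => // w.
by rewrite rE; exact: coercive_bounded_norm cb.
Qed.

(** For each z in K, the left-hand side is the sum of a term bounded by the candidate for e_K at z,
    a term bounded by e_h(u), and (f, z - u) - a(u, z - u) <= 0. *)
Lemma feasibility_error_ge f phi VT p Pi Ch u v : open Om -> L2 Om f ->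
  between_P0_P1 Om M VT -> reconstruction Om M VT p -> conforming_operator Om M Ch ->
  solves_VI Om f phi u ->
  ip Om f (p (v - Pi u)) - dirichlet Om u (Ch (p (v - Pi u))) <=
  feasibility_error Om f phi p Ch u v + interpolation_error Om f p Pi Ch u.
Proof.
move=> oOm Lf hVT hp hCh [uK uVI].
have Hu : H1 Om u by case: uK => -[].
have Lp y := reconstruction_L2 y hVT hp.
have ld := scalar_dirichlet_operator oOm hVT hp hCh Hu.
have lf := scalar_ip_reconstruction hVT hp Lf.
have H1Ch y : H1 Om (Ch (p y)) by case: hCh => /(_ _ (Lp y))[_ []].
have dB z y : H1 Om z -> dirichlet Om u (Ch (p y) \- z) =
  dirichlet Om u (Ch (p y)) - dirichlet Om u z by move=> Hz; apply: dirichletBr => //; exact: H1Ch.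
have fB z y : L2 Om z -> ip Om f (p y \- z) = ip Om f (p y) - ip Om f z.
  by move=> Lz; apply: ipBr => //; exact: Lp.
rewrite (scalarB _ _ lf) (scalarB _ _ ld) -lerBlDr /=.
(* [u] itself shows that the infimum is over a nonempty set. *)
apply: lb_le_inf; first by eexists; exists u.
move=> _ [z zK <-]; have Hz : H1 Om z by case: zK => -[].
have [Lu _] := Hu; have [Lz _] := Hz.
have := uVI z zK; rewrite (ipBr Lz Lu Lf) (dirichletBr oOm Hu Hz Hu).
rewrite /interpolation_error /= !dB// !fB//.
move: (dirichlet Om u (Ch (p v))) (dirichlet Om u (Ch (p (Pi u)))) (dirichlet Om u z).
move: (dirichlet Om u u) (ip Om f (p v)) (ip Om f (p (Pi u))) (ip Om f z) (ip Om f u).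
move=> du fv fPi fz fu dv dPi dz VI.
have := ler_norm (- (dv - dz - (fv - fz))); rewrite normrN.
have := ler_norm (dPi - du - (fPi - fu)).
by lra.
Qed.

End discrete_scheme.

(** * Summation over the iterations and the error estimate *)

Theorem theorem5p5 (R : realType) (n : nat) (hn : n = 2%N \/ n = 3%N)
  (Om : set 'rV[R]_n) (hOm : lipschitz_domain Om)
  (f phi : 'rV[R]_n -> R) (hf : L2 Om f) (hphi : admissible_obstacle Om phi)
  (u : 'rV[R]_n -> R) (hu : solves_VI Om f phi u)
  (Rf : 'rV[R]_n -> R -> \bar R) (hRf : legendre_setting Om phi Rf)
  (M : mesh R n) (hM : conforming_partition Om M)
  (kappa : R) (hkappa : shape_regular M kappa)
  (Vh : normedModType R) (hVh : finite_dimensional Vh)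
  (VT : set ('rV[R]_n -> R)) (hVT : between_P0_P1 Om M VT)
  (p : Vh -> 'rV[R]_n -> R) (hp : reconstruction Om M VT p)
  (ah : Vh -> Vh -> R) (hah : symmetric_bilinear ah)
  (Ccoerc Ccont Cp CPi : R)
  (hCcoerc : 0 < Ccoerc) (hCcont : 0 < Ccont) (hCp : 0 < Cp) (hCPi : 0 < CPi)
  (hah_bounds : coercive_bounded ah Ccoerc Ccont)
  (hp_bound : forall v, normDG M (p v) <= Cp * `|v|)
  (Pi : ('rV[R]_n -> R) -> Vh) (hPi : quasi_interpolation Om M p CPi Pi)
  (alpha : nat -> R) (halpha : forall k, (1 <= k)%N -> 0 < alpha k)
  (halpha_sum : (\sum_(1 <= k < N.+1) alpha k) @[N --> \oo] --> +oo)
  (uh : nat -> Vh) (psi : nat -> 'rV[R]_n -> R)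
  (hiter : iterates Om M f Rf p ah alpha uh psi)
  (Ch : ('rV[R]_n -> R) -> 'rV[R]_n -> R) (hCh : conforming_operator Om M Ch)
  (m : nat) (hm : (1 <= m)%N) :
  let o := fun k => grad_Rstar Rf (psi k) in
  let S := \sum_(1 <= k < m.+1) alpha k in
  ((Ccoerc / 4 * `|uh m - Pi u| ^+ 2)%:E
     + bregman_integral Om Rf u (o m) * (S^-1)%:E
   <= bregman_integral Om Rf u (o 0%N) * (S^-1)%:E
     + (Ccoerc^-1 * dual_norm (consistency_error Om p ah Pi Ch u) ^+ 2)%:E
     + (feasibility_error Om f phi p Ch u (uh m))%:E
     + (interpolation_error Om f p Pi Ch u)%:E)%E.
Proof.
cbv zeta; set S := \sum_(1 <= k < m.+1) alpha k.
pose o k := grad_Rstar Rf (psi k).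
have n0 : (0 < n)%N by case: hn => ->.
have oOm : open Om by case: hOm.
have [uK uVI] := hu; have [[Hu _] phu] := uK; have [Lu _] := Hu.
have [_ _ _ [oL2 _ omono]] := hRf.
have [psiP0 iter] := hiter.
have psiLoo k : Linfty Om (psi k) by exact: broken_poly0_Linfty (psiP0 k).
have Lo k : L2 Om (o k) by have [[]] := oL2 _ (psiLoo k).
have Lpsi k : L2 Om (psi k) by have [] := psiP0 k.
have Lp v := reconstruction_L2 v hVT hp.
have [ahC ahl] := hah; have [coer _] := hah_bounds.
have ah0 v : 0 <= ah v v by apply: le_trans (coer v); rewrite mulr_ge0 ?sqr_ge0// ltW.
pose L v := ip Om f (p v).
have LP : scalar L := scalar_ip_reconstruction hVT hp hf.
pose En := energy ah L.
pose I k := bregman_integral Om Rf u (o k).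
have I0 k : (0 <= I k)%E by exact: bregman_integral_ge0 hRf _ _ phu.
pose dpsi k := psi k \- psi k.-1.
have Ldpsi k : L2 Om (dpsi k) by exact: L2B.
have P0dpsi k : broken_poly Om M 0 (dpsi k) by exact: broken_poly0B.
have [_ _ Piorth _] := hPi.
have bu : broken_H1 Om M u := broken_H1_H1 hM Hu.
have ipp v w k : ip Om (p (v - w)) (dpsi k) = ip Om (p v) (dpsi k) - ip Om (p w) (dpsi k).
  rewrite !(ipC Om (p _)).
  exact: (scalarB _ _ (scalar_ip_reconstruction hVT hp (Ldpsi k))).
have decrease k : (1 <= k)%N ->
    (I k + (alpha k * (En (uh k) - En (Pi u)))%:E <= I k.-1)%E.
  move=> k1; have [eq1 eq2] := iter k k1.
  apply: le_trans (bregman_integral_step hRf phu (Ldpsi k) (L2B Lu (Lo k))).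
  apply: leeD2l; rewrite lee_fin.
  have -> : ip Om (psi k \- psi k.-1) (u \- grad_Rstar Rf (psi k)) =
      alpha k * (ah (uh k) (uh k - Pi u) - L (uh k - Pi u)).
    (* Against the piecewise constant [dpsi k], the moments of [Pi] replace [p (Pi u)] by [u], and
       the second equation replaces [p (uh k)] by [o k]. *)
    have e2 : ip Om (p (Pi u)) (dpsi k) = ip Om u (dpsi k).
      by apply/eqP; rewrite -subr_eq0 -(ipBl (Lp _) Lu (Ldpsi k)) Piorth.
    have e1 : ah (uh k) (uh k - Pi u) +
        (alpha k)^-1 * (ip Om (o k) (dpsi k) - ip Om u (dpsi k)) = L (uh k - Pi u).
      by rewrite -e2 -(eq2 _ (P0dpsi k)) -ipp; exact: eq1.
    have -> : ip Om (psi k \- psi k.-1) (u \- grad_Rstar Rf (psi k)) =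
        ip Om u (dpsi k) - ip Om (o k) (dpsi k).
      by rewrite -(ipBl Lu (Lo k) (Ldpsi k)) ipC.
    by rewrite -e1; field; rewrite gt_eqF// halpha.
  apply: ler_wpM2l; first by rewrite ltW// halpha.
  exact: energyB_le.
(* The second equation is needed at both [k] and [k.+1], which excludes [k = 0]. *)
have En_decr k : (1 <= k)%N -> En (uh k.+1) <= En (uh k).
  move=> k1; rewrite -subr_le0; apply: le_trans (energyB_le hah LP ah0 _ _) _.
  have [eq1 eq2] := iter k.+1 isT; have [_ eq2'] := iter k k1.
  have mono : 0 <= ip Om (o k.+1 \- o k) (dpsi k.+1).
    (* Strict monotonicity says nothing about functions equal a.e.; for these the product is
       zero. *)
    have [psiE|psiN] := pselect (psi k.+1 = psi k %[ae lebesgue R n in Om]).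
      rewrite (_ : ip _ _ _ = 0)//.
      rewrite (@ip_ae _ _ _ (o k.+1 \- o k) (o k.+1 \- o k) _ (psi k \- psi k)).
      - by rewrite ipBr// ?subrr//; exact: L2B.
      - exact/nearW.
      - by apply: filterS psiE => x psix Omx; rewrite /dpsi /= psix.
    exact/ltW/omono.
  have e1 : ah (uh k.+1) (uh k.+1 - uh k) +
      (alpha k.+1)^-1 * ip Om (o k.+1 \- o k) (dpsi k.+1) = L (uh k.+1 - uh k).
    rewrite (ipBl (Lo _) (Lo _) (Ldpsi _)) -(eq2 _ (P0dpsi k.+1)).
    by rewrite -(eq2' _ (P0dpsi k.+1)) -ipp; exact: eq1.
  by rewrite -e1 opprD addrA subrr sub0r oppr_le0 mulr_ge0// invr_ge0 ltW// halpha.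
pose Sk k := \sum_(1 <= j < k.+1) alpha j.
have SkS k : Sk k.+1 = Sk k + alpha k.+1 by rewrite /Sk big_nat_recr.
have Sk_gt0 k : (0 < k)%N -> 0 < Sk k.
  elim: k => // -[_ _|k IH _]; rewrite SkS ltr_wpDl ?halpha//.
    by rewrite /Sk big_geq.
  by rewrite ltW// IH.
(* Decreasing energies let the latest gap carry the whole accumulated weight. At [k = 0] that weight
   is 0, so nothing is asked of [uh 0]. *)
have tele k : (I k + (Sk k * (En (uh k) - En (Pi u)))%:E <= I 0%N)%E.
  elim: k => [|k IH]; first by rewrite /Sk big_geq// mul0r adde0.
  have := decrease k.+1 isT; rewrite -pred_Sn.
  have : Sk k * (En (uh k.+1) - En (Pi u)) <= Sk k * (En (uh k) - En (Pi u)).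
    case: (posnP k) => [->|k0]; first by rewrite /Sk big_geq// !mul0r.
    by apply: ler_wpM2l; [exact/ltW/Sk_gt0|rewrite lerD2r; exact: En_decr].
  rewrite SkS mulrDl; move: IH.
  move: (En (uh k.+1) - _) (En (uh k) - _) (I k.+1) (I k) (I 0%N) => x y I2 I1 I00.
  move=> IH le_xy le_I; apply: le_trans IH.
  rewrite [X in X%:E]addrC EFinD addeA.
  by apply: (leeD le_I); rewrite lee_fin.
have S0 : 0 < S by exact: Sk_gt0.
set e := uh m - Pi u; set del := consistency_error Om p ah Pi Ch u.
have [_ del_le] := consistency_error_le Pi oOm hVh hVT hp hCh Hu hah hCcoerc hah_bounds.
have fe := feasibility_error_ge Pi (uh m) oOm hf hVT hp hCh hu.
set F := feasibility_error _ _ _ _ _ _ _ in fe *.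
set J := interpolation_error _ _ _ _ _ _ in fe *.
(* Half of a_h(e, e) provides [Ccoerc / 2]; Young's inequality for the consistency error spends
   [Ccoerc / 4] of it, and the remainder is the constant of the theorem. *)
have lower : Ccoerc / 4 * `|e| ^+ 2 <= En (uh m) - En (Pi u) +
    Ccoerc^-1 * dual_norm del ^+ 2 + F + J.
  rewrite (energyB_right hah LP) -/e.
  have := del_le e; rewrite ler_norml => /andP[+ _].
  rewrite {2}/consistency_error -/del; have := coer e; move: fe.
  rewrite -/e -/(L e).
  move: (`|e| ^+ 2) (ah e e) (L e) (ah (Pi u) e) (dirichlet _ _ _) => ee aee Le ae di.
  move: (dual_norm _ ^+ 2) => d; move: (Ccoerc^-1 * d) => cd.
  lra.
have := tele m; rewrite -/S; move: (I0 m) (I0 0%N); rewrite -/(o m) -/(o 0%N) -/(I m) -/(I 0%N).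
move: lower; move: (En _ - En _) (_ / 4 * _) (_^-1 * _ ^+ 2) => de A D.
have SV : S^-1 * S = 1 by rewrite mulVf// gt_eqF.
have SV0 : 0 < S^-1 by rewrite invr_gt0.
(* An infinite initial divergence makes the right-hand side infinite; a finite one forces [I m] to
   be finite through [tele]. *)
case: (I 0%N) => [r0| |] //; last first.
  by move=> _ _ _ _; rewrite gt0_mulye ?lte_fin// !addye// leey.
case: (I m) => [rm| |] // lower _ _; rewrite -!EFinM -!EFinD !lee_fin => t.
have : S^-1 * (rm + S * de) <= S^-1 * r0 by rewrite ler_wpM2l// ltW.
by rewrite mulrDr mulrA SV mul1r; lra.
Qed.
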